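(* Let $L_1,L_2,T,K_1,K_2>0$, $\beta,\gamma\in(1,2]$, let $M_1,M_2\ge2$, $N\ge1$, $J\ge1$ be integers, and let $h_1=L_1/M_1$, $h_2=L_2/M_2$, $\tau=T/N$, $x_i=ih_1$, $y_j=jh_2$, $t_n=n\tau$, $t_{n-1+\sigma}=(n-1+\sigma)\tau$, where $\sigma\in[\frac12,1]$ and $m$, $\alpha_r$, $\lambda_r$, $\hat c_k^{(n)}$, $g_k^{(\beta)}$, $g_k^{(\gamma)}$, $c_*^{(\beta)}$, $c_*^{(\gamma)}$ are as defined in the context. Given functions $f$ and $\phi$, put $f_{ij}^{n-1+\sigma}=f(x_i,y_j,t_{n-1+\sigma})$, and let $\{u_{ij}^n: 0\le i\le M_1,\ 0\le j\le M_2,\ 0\le n\le N\}$ be the solution of the difference scheme $$\sum_{k=0}^{n-1}\hat c_k^{(n)}\left(u_{ij}^{n-k}-u_{ij}^{n-k-1}\right)=-K_1h_1^{-\beta}\sum_{k=i-M_1}^{i}g_k^{(\beta)}\left[\sigma u_{i-k,j}^n+(1-\sigma)u_{i-k,j}^{n-1}\right]-K_2h_2^{-\gamma}\sum_{k=j-M_2}^{j}g_k^{(\gamma)}\left[\sigma u_{i,j-k}^n+(1-\sigma)u_{i,j-k}^{n-1}\right]+f_{ij}^{n-1+\sigma}$$ for $1\le i\le M_1-1$, $1\le j\le M_2-1$, $1\le n\le N$, with $$u_{ij}^n=0\ \text{ for boundary indices } (i\in\{0,M_1\}\text{ or }j\in\{0,M_2\}),\ 0\le n\le N,\qquad u_{ij}^0=\phi(x_i,y_j),\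 1\le i\le M_1-1,\ 1\le j\le M_2-1.$$ Then $$\|u^n\|^2\le\|u^0\|^2+\frac14\left[\frac{(2L_1)^\beta}{K_1c_*^{(\beta)}}+\frac{(2L_2)^\gamma}{K_2c_*^{(\gamma)}}\right]\frac{1}{\sum_{r=0}^{m}\frac{\lambda_r}{T^{\alpha_r}\Gamma(1-\alpha_r)}}\max_{1\le l\le n}\|f^{l-1+\sigma}\|^2,\quad 1\le n\le N,$$ where $\|u^n\|^2=h_1h_2\sum_{i=1}^{M_1-1}\sum_{j=1}^{M_2-1}(u_{ij}^n)^2$ and $\|f^{l-1+\sigma}\|^2=h_1h_2\sum_{i=1}^{M_1-1}\sum_{j=1}^{M_2-1}\left(f_{ij}^{l-1+\sigma}\right)^2$.
   Context: Weight function: $\omega:[0,1]\to\mathbb{R}$ satisfies $\omega(\alpha)\ge 0$ and $\omega(\alpha)\ne0$ for $\alpha\in[0,1]$, and $0<\int_0^1\omega(\alpha)\,d\alpha<\infty$. Set $m=2J$, $\Delta\alpha=\frac1{2J}$, $\alpha_r=r\Delta\alpha$ for $0\le r\le m$, $d_0=d_m=\frac12$, $d_r=1$ for $1\le r\le m-1$, and $\lambda_r=d_r\omega(\alpha_r)\Delta\alpha>0$. $\sigma$ is the unique positive root (it lies in $[\frac12,1]$) of $$F(\sigma)=\sum_{r=0}^{m}\frac{\lambda_r}{\Gamma(3-\alpha_r)}\sigma^{1-\alpha_r}\left[\sigma-\left(1-\frac{\alpha_r}{2}\right)\right]\tau^{2-\alpha_r}=0 .$$ For $\alpha\in[0,1]$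 let $a_0^{(\alpha)}=\sigma^{1-\alpha}$ and, for $l\ge1$, $a_l^{(\alpha)}=(l+\sigma)^{1-\alpha}-(l-1+\sigma)^{1-\alpha}$ and $$b_l^{(\alpha)}=\frac{1}{2-\alpha}\left[(l+\sigma)^{2-\alpha}-(l-1+\sigma)^{2-\alpha}\right]-\frac12\left[(l+\sigma)^{1-\alpha}+(l-1+\sigma)^{1-\alpha}\right].$$ Let $c_0^{(1,\alpha)}=a_0^{(\alpha)}$, and for $n\ge2$: $c_0^{(n,\alpha)}=a_0^{(\alpha)}+b_1^{(\alpha)}$; $c_k^{(n,\alpha)}=a_k^{(\alpha)}+b_{k+1}^{(\alpha)}-b_k^{(\alpha)}$ for $1\le k\le n-2$; $c_{n-1}^{(n,\alpha)}=a_{n-1}^{(\alpha)}-b_{n-1}^{(\alpha)}$. Define $$\hat c_k^{(n)}=\sum_{r=0}^{m}\lambda_r\frac{\tau^{-\alpha_r}}{\Gamma(2-\alpha_r)}c_k^{(n,\alpha_r)},\quad 0\le k\le n-1 .$$ For $k\in\mathbb{Z}$ and $s\in(1,2]$, $g_k^{(s)}=\dfrac{(-1)^k\Gamma(s+1)}{\Gamma(s/2-k+1)\Gamma(s/2+k+1)}$. The convention $1/\Gamma(z)=0$ at the poles of $\Gamma$ is used throughout (in particular $1/\Gamma(1-\alpha_m)=0$ since $\alpha_m=1$). For $s\in(1,2]$, $c_*^{(s)}=\frac{2}{s}r_s$ with $$r_s=e^{-2}\frac{(4-s)(2-s)s}{(6+s)(4+s)(2+s)}\cdot\frac{\Gamma(s+1)}{\Gamma^2(s/2+1)}\left(3+\frac{s}{2}\right)^{s+1}.$$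 For $s=2$ one has $c_*^{(s)}=0$; the coefficient $1/c_*^{(s)}$ is then read as $+\infty$, so the estimate carries no information in that case. The function $\phi$ is assumed to vanish on the boundary of $(0,L_1)\times(0,L_2)$. *)

(* Defs.v *)
From HB Require Import structures.
From mathcomp Require Export all_boot all_order all_algebra.
From mathcomp Require Export all_classical all_reals all_analysis.
Export Order.TTheory GRing.Theory Num.Theory.

Set Implicit Arguments.
Unset Strict Implicit.
Unset Printing Implicit Defensive.

Local Open Scope classical_set_scope.
Local Open Scope ring_scope.

Definition euler_integral (R : realType) (z : R) : R :=
  \int[lebesgue_measure]_(t in `]0, +oo[) (t `^ (z - 1) * expR (- t)).

(* Euler's integral for z > 0, continued to z <= 0 by
   Gamma (z + n) = z (z + 1) ... (z + n - 1) Gamma z, where n is the least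
   integer with z + n > 0.  At the poles z = 0, -1, -2, ... the product
   vanishes, so that Gamma z = 0 and (Gamma z)^-1 = 0 by the conventions of
   division: this is the convention 1 / Gamma z = 0 at the poles. *)
Definition Gamma (R : realType) (z : R) : R :=
  if 0 < z then euler_integral z
  else let n := (Num.truncn (- z)).+1 in
       euler_integral (z + n%:R) / \prod_(i < n) (z + i%:R).

Definition alpha (R : realType) (J r : nat) : R := r%:R / (2 * J)%:R.

(* Weights of the composite trapezoidal rule on [0, 1] with 2 J steps. *)
Definition lambda (R : realType) (omega : R -> R) (J r : nat) : R :=
  (if (r == 0)%N || (r == 2 * J)%N then 2^-1 else 1) *
  omega (alpha R J r) * (2 * J)%:R^-1.

Definition sigmaF (R : realType) (omega : R -> R) (J : nat) (tau s : R) : R :=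
  \sum_(0 <= r < (2 * J).+1)
    lambda omega J r / Gamma (3 - alpha R J r) *
    s `^ (1 - alpha R J r) * (s - (1 - alpha R J r / 2)) *
    tau `^ (2 - alpha R J r).

(* The positive root is unique when the weights are positive, and it then lies
   in [1/2, 1]. *)
Definition is_sigma (R : realType) (omega : R -> R) (J : nat)
    (tau sigma : R) : Prop :=
  0 < sigma /\ sigmaF omega J tau sigma = 0.

Definition coef_a (R : realType) (sigma al : R) (l : nat) : R :=
  if (l == 0)%N then sigma `^ (1 - al)
  else (l%:R + sigma) `^ (1 - al) - (l%:R - 1 + sigma) `^ (1 - al).

(* Only used for l >= 1. *)
Definition coef_b (R : realType) (sigma al : R) (l : nat) : R :=
  (2 - al)^-1 *
    ((l%:R + sigma) `^ (2 - al) - (l%:R - 1 + sigma) `^ (2 - al)) -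
  2^-1 * ((l%:R + sigma) `^ (1 - al) + (l%:R - 1 + sigma) `^ (1 - al)).

(* c_k^(n, al), for n >= 1 and k <= n - 1; the last branch is k = n - 1. *)
Definition coef_c (R : realType) (sigma al : R) (n k : nat) : R :=
  if (n == 1)%N then coef_a sigma al 0
  else if (k == 0)%N then coef_a sigma al 0 + coef_b sigma al 1
  else if (k <= n - 2)%N then
    coef_a sigma al k + coef_b sigma al k.+1 - coef_b sigma al k
  else coef_a sigma al k - coef_b sigma al k.

Definition chat (R : realType) (omega : R -> R) (J : nat) (tau sigma : R)
    (n k : nat) : R :=
  \sum_(0 <= r < (2 * J).+1)
    lambda omega J r * (tau `^ (- alpha R J r) / Gamma (2 - alpha R J r)) *
    coef_c sigma (alpha R J r) n k.

Definition coef_g (R : realType) (s : R) (k : int) : R :=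
  (-1) ^ k * Gamma (s + 1) /
  (Gamma (s / 2 - k%:~R + 1) * Gamma (s / 2 + k%:~R + 1)).

Definition coef_r (R : realType) (s : R) : R :=
  expR (- 2) *
  (((4 - s) * (2 - s) * s) / ((6 + s) * (4 + s) * (2 + s))) *
  (Gamma (s + 1) / Gamma (s / 2 + 1) ^+ 2) *
  (3 + s / 2) `^ (s + 1).

Definition cstar (R : realType) (s : R) : R := 2 / s * coef_r s.

(* The sum of g_k^(s) v_(i-k) over i - M <= k <= i, indexed by p = i - k. *)
Definition riesz_sum (R : realType) (s : R) (M : nat) (v : nat -> R)
    (i : nat) : R :=
  \sum_(0 <= p < M.+1) coef_g s (i%:Z - p%:Z) * v p.

Definition is_scheme_solution (R : realType) (L1 L2 T K1 K2 beta gamma : R)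
    (M1 M2 N J : nat) (omega : R -> R) (sigma : R)
    (f : R -> R -> R -> R) (phi : R -> R -> R)
    (u : nat -> nat -> nat -> R) : Prop :=
  let h1 := L1 / M1%:R in
  let h2 := L2 / M2%:R in
  let tau := T / N%:R in
  [/\ forall n i j : nat, (1 <= n <= N)%N ->
        (1 <= i <= M1 - 1)%N -> (1 <= j <= M2 - 1)%N ->
        \sum_(0 <= k < n)
          chat omega J tau sigma n k * (u (n - k)%N i j - u (n - k - 1)%N i j)
        = - K1 * h1 `^ (- beta) *
            riesz_sum beta M1
              (fun p => sigma * u n p j + (1 - sigma) * u (n - 1)%N p j) i
          - K2 * h2 `^ (- gamma) *
            riesz_sum gamma M2
              (fun q => sigma * u n i q + (1 - sigma) * u (n - 1)%N i q) j
          + f (i%:R * h1) (j%:R * h2) ((n%:R - 1 + sigma) * tau),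
      forall n i j : nat, (n <= N)%N -> (i <= M1)%N -> (j <= M2)%N ->
        (i = 0 \/ i = M1 \/ j = 0 \/ j = M2)%N -> u n i j = 0
    & forall i j : nat, (1 <= i <= M1 - 1)%N -> (1 <= j <= M2 - 1)%N ->
        u 0%N i j = phi (i%:R * h1) (j%:R * h2)].

Definition normsq (R : realType) (M1 M2 : nat) (h1 h2 : R)
    (v : nat -> nat -> R) : R :=
  h1 * h2 * \sum_(1 <= i < M1) \sum_(1 <= j < M2) v i j ^+ 2.

(* C x, except that it is +oo for every x, including x = 0, when C = +oo
   (in \bar R, +oo * 0 = 0). *)
Definition scale_bound (R : realType) (C : \bar R) (x : R) : \bar R :=
  if C is r%:E then (r * x)%:E else +oo%E.

(* Main.v *)
Require Import Defs.
From mathcomp Require Import measurable_realfun ring lra zify.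

(** The estimate is a discrete energy inequality.  Fix a time level n, put
    w = sigma u^n + (1 - sigma) u^(n-1) and c_k = chat_k^(n), multiply the scheme
    by h1 h2 w and sum over the grid.  Three facts combine.

    Time.  With E_k = (w - u^(n-k))^2 one has, at each grid point,
      (u^(n-k) - u^(n-k-1)) w - ((u^(n-k))^2 - (u^(n-k-1))^2) / 2
        = (E_(k+1) - E_k) / 2.
    Summation by parts against coefficients that decrease from k = 1 on leaves
    only c_0 (E_1 - E_0) - c_1 E_1, where E_0 = (1 - sigma)^2 d^2 and
    E_1 = sigma^2 d^2 with d = u^n - u^(n-1).  Hence the discrete derivative
    tested against w dominates half the discrete derivative of the squared
    norm as soon as sigma^2 c_1 <= (2 sigma - 1) c_0
    ([discrete_energy_ge]).  This inequality is where sigma comes in: for a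
    single order al, (2 sigma - 1) c_0 - sigma^2 c_1 is at least
      2 sigma^(1-al) (sigma - (1 - al/2)) / (2 - al),
    by the concavity of x^(1-al) alone ([coef_c_first_ge]), and the weighted sum
    of these lower bounds over the orders is a multiple of F(sigma) = 0
    ([chat_first_ge]).  It also gives c_1 <= c_0, because
    sigma^2 - (2 sigma - 1) is a square, while the individual c_0^(n, al) may be
    smaller than c_1^(n, al).  The remaining monotonicity holds order by order:
    b_l is the error of the trapezoidal rule for the concave function x^(1-al),
    so that b_l >= 0, and both b_l and a_l - b_l decrease with l.

    Space.  The coefficients g_k satisfy
    g_(k+1) (s/2 + k + 1) = g_k (k - s/2) by the functional equation of Gamma,
    so that they telescope: g_k = V_(k+1) - V_k for
    V_k = - (s/2 + k) g_k / s ([riesz_tail_succ]).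
    Row i of the Toeplitz matrix (g_(i-p)), 1 <= i, p <= M - 1, therefore sums
    to V_i + V_(M-i) exactly.  As the off-diagonal entries are nonpositive and
    the matrix is symmetric, its quadratic form is at least
    the sum of (V_i + V_(M-i)) v_i^2, hence at least 2 V_M times the sum of the
    v_i^2.  The ratio V_(k+1) / V_k = (k - s/2) / (k + s/2) is at least
    ((k - 1) / k)^s, which yields V_M >= (r_s / s) (2 M)^(-s)
    ([riesz_tail_ge_coef_r]).

    Conclusion.  Let B = K1 cstar(beta) / (2 L1)^beta
    + K2 cstar(gamma) / (2 L2)^gamma and let S be the sum of the
    lambda_r / (T^(alpha_r) Gamma(1 - alpha_r)).  Young's inequality
    f w <= B w^2 + f^2 / (4 B) absorbs w, and
    the sum of c_k (||u^(n-k)||^2 - ||u^(n-k-1)||^2) is at most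
    ||f||^2 / (2 B).  Since c_(n-1) >= S / 2 ([chat_last_ge]), induction on n
    bounds ||u^n||^2 by ||u^0||^2 + max ||f||^2 / (B S), and
    1 / (x + y) <= (1 / x + 1 / y) / 4 turns 1 / B into the stated constant. *)

Import numFieldNormedType.Exports.
Set Implicit Arguments.
Unset Strict Implicit.
Unset Printing Implicit Defensive.
Local Open Scope classical_set_scope.
Local Open Scope ring_scope.

(** * Tangent inequalities for real powers *)

Section power_inequalities.
Variable R : realType.
Implicit Types x y z p q : R.

Lemma ln_le_subr1 x : 0 < x -> ln x <= x - 1.
Proof.
by move=> x0; rewrite -{1}(subrKC 1 x); apply: le_ln1Dx; rewrite ltrBrDl subrr.
Qed.

(** Bernoulli's inequality, that is the weighted inequality of arithmetic and
    geometric means of z and 1: with m = q z + (1 - q) it is the combination of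
    ln (z / m) <= z / m - 1 and ln (1 / m) <= 1 / m - 1 with weights q and
    1 - q. *)
Lemma powR_le_tangent1 z q : 0 < z -> 0 <= q <= 1 -> z `^ q <= 1 + q * (z - 1).
Proof.
move=> z0 /andP[q0 q1].
set m := 1 + q * (z - 1).
have m0 : 0 < m by rewrite /m; nra.
rewrite /powR gt_eqF// -[leRHS]lnK ?posrE// ler_expR.
have lz : ln z <= z / m - 1 + ln m.
  have := ln_le_subr1 (divr_gt0 z0 m0).
  by rewrite ln_div ?posrE//; lra.
have lm : - ln m <= m^-1 - 1.
  by rewrite -lnV ?posrE//; apply: ln_le_subr1; rewrite invr_gt0.
have e : q * (z / m - 1) + (1 - q) * (m^-1 - 1) = 0.
  by rewrite /m; field; rewrite -/m gt_eqF.
have := ler_wpM2l q0 lz.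
have q1' : 0 <= 1 - q by lra.
have := ler_wpM2l q1' lm.
rewrite /m in e *; nra.
Qed.

Lemma powR_ge_tangent1_neg z q : 0 < z -> -1 <= q <= 0 ->
  1 + q * (z - 1) <= z `^ q.
Proof.
move=> z0 /andP[q0 q1].
have h : z `^ (- q) <= 1 + - q * (z - 1).
  by apply: powR_le_tangent1 => //; lra.
have p0 : 0 < z `^ (- q) by apply: powR_gt0.
have m0 : 0 < 1 + - q * (z - 1) by apply: lt_le_trans h.
rewrite -[q in leRHS]opprK powRN.
have : (1 + - q * (z - 1))^-1 <= (z `^ (- q))^-1 by rewrite lef_pV2.
apply: le_trans.
rewrite -[leRHS]mul1r ler_pdivlMr//.
by have := sqr_ge0 (q * (z - 1)); rewrite expr2; lra.
Qed.

Lemma powRS x p : 0 < x -> x `^ (p + 1) = x * x `^ p.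
Proof.
move=> x0; rewrite powRD ?powRr1 ?(ltW x0) 1?mulrC//.
by apply/implyP => _; rewrite gt_eqF.
Qed.

Lemma powRB1 x p : 0 < x -> x `^ p = x * x `^ (p - 1).
Proof. by move=> x0; rewrite -powRS// subrK. Qed.

(** Deduced from Bernoulli's inequality at 1 / z: after clearing denominators
    the gap between the two bounds is the square of p (z - 1). *)
Lemma powR_ge_tangent1_succ z p : 0 < z -> 0 <= p <= 1 ->
  1 + (p + 1) * (z - 1) <= z `^ (p + 1).
Proof.
move=> z0 /andP[p0 p1].
have zi0 : 0 < z^-1 by rewrite invr_gt0.
have h : z^-1 `^ p <= 1 + p * (z^-1 - 1).
  by apply: powR_le_tangent1 => //; rewrite p0.
have e : z^-1 `^ p * z `^ p = 1.
  by rewrite -powRM ?(ltW z0) ?(ltW zi0)// mulVf ?gt_eqF// powR1.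
have P0 : 0 < z `^ p by apply: powR_gt0.
have h2 : z <= (z + p * (1 - z)) * z `^ p.
  have := ler_wpM2r (ltW (mulr_gt0 z0 P0)) h.
  rewrite mulrCA e mulr1 => /le_trans; apply.
  suff -> : (1 + p * (z^-1 - 1)) * (z * z `^ p) = (z + p * (1 - z)) * z `^ p by [].
  by field; rewrite gt_eqF.
rewrite powRS//.
have d0 : 0 < z + p * (1 - z) by nra.
rewrite -(ler_pM2l d0).
apply: (@le_trans _ _ (z * z)); last first.
  by rewrite mulrCA ler_pM2l.
rewrite -subr_ge0.
have -> : z * z - (z + p * (1 - z)) * (1 + (p + 1) * (z - 1)) = (p * (z - 1)) ^+ 2.
  by ring.
exact: sqr_ge0.
Qed.

Let powR_ratio x y q : 0 < x -> 0 < y -> y `^ q = x `^ q * (y / x) `^ q.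
Proof.
move=> x0 y0; rewrite -powRM ?(ltW x0) ?divr_ge0 ?ltW//.
by rewrite mulrCA divff ?mulr1 ?gt_eqF.
Qed.

Let tangentE x y q : 0 < x ->
  x `^ q * (1 + q * (y / x - 1)) = x `^ q + q * x `^ (q - 1) * (y - x).
Proof.
by move=> x0; rewrite [x `^ q]powRB1//; field; rewrite gt_eqF.
Qed.

(** The tangent at 1 is moved to an arbitrary point x > 0 by homogeneity. *)
Lemma powR_le_tangent x y q : 0 < x -> 0 < y -> 0 <= q <= 1 ->
  y `^ q <= x `^ q + q * x `^ (q - 1) * (y - x).
Proof.
move=> x0 y0 q01; rewrite -tangentE// (powR_ratio q x0 y0).
by rewrite ler_wpM2l ?powR_ge0// powR_le_tangent1// divr_gt0.
Qed.

Lemma powR_ge_tangent_neg x y q : 0 < x -> 0 < y -> -1 <= q <= 0 ->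
  x `^ q + q * x `^ (q - 1) * (y - x) <= y `^ q.
Proof.
move=> x0 y0 q01; rewrite -tangentE// (powR_ratio q x0 y0).
by rewrite ler_wpM2l ?powR_ge0// powR_ge_tangent1_neg// divr_gt0.
Qed.

Lemma powR_ge_tangent_succ x y p : 0 < x -> 0 < y -> 0 <= p <= 1 ->
  x `^ (p + 1) + (p + 1) * x `^ p * (y - x) <= y `^ (p + 1).
Proof.
move=> x0 y0 q01; have := @tangentE x y (p + 1) x0; rewrite addrK => <-.
rewrite (powR_ratio (p + 1) x0 y0).
by rewrite ler_wpM2l ?powR_ge0// powR_ge_tangent1_succ// divr_gt0.
Qed.

Lemma ler_powR_npos x y q : 0 < x -> x <= y -> q <= 0 -> y `^ q <= x `^ q.
Proof.
move=> x0 xy q0; have y0 := lt_le_trans x0 xy.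
rewrite -[q]opprK powRN [leRHS]powRN lef_pV2 ?posrE ?powR_gt0//.
by rewrite ge0_ler_powR ?nnegrE ?oppr_ge0 ?(ltW x0) ?(ltW y0).
Qed.

Lemma le_of_derive_ge0 (F dF : R -> R) a b : a <= b ->
  (forall x, a <= x <= b -> is_derive x 1 F (dF x)) ->
  (forall x, a <= x <= b -> 0 <= dF x) -> F a <= F b.
Proof.
move=> ab FdF dF0.
have d x : x \in `]a, b[%R -> is_derive x 1 F (dF x).
  by move=> /[!in_itv]/= /andP[ax xb]; apply: FdF; rewrite !ltW.
have cF : {within `[a, b], continuous F}.
  apply: derivable_within_continuous => x /[!in_itv]/= xab.
  by have [] := FdF x xab.
have [c] := MVT_segment ab d cF.
by move=> /[!in_itv]/= cab e; rewrite -subr_ge0 e mulr_ge0 ?dF0 ?subr_ge0.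
Qed.

End power_inequalities.

(** * Increments and trapezoidal errors of x^p over a unit cell *)

Section power_cells.
Variable R : realType.
Implicit Types x y z p q : R.

Definition power_incr p x : R := (x + 1) `^ p - x `^ p.

(** The integral of t^p over the cell [x, x + 1] minus its trapezoidal
    approximation. *)
Definition trapezoid_gap p x : R :=
  (p + 1)^-1 * ((x + 1) `^ (p + 1) - x `^ (p + 1)) -
  2^-1 * ((x + 1) `^ p + x `^ p).

(** Up to the constant x^(q+1), the trapezoidal error on [x, y], scaled by
    q + 1 so that no division is needed at q = -1. *)
Let trapezoid_defect q x y : R :=
  y `^ (q + 1) - (q + 1) / 2 * (y - x) * (y `^ q + x `^ q).

Let trapezoid_defect_derive q x y : 0 < y ->
  is_derive y 1 (trapezoid_defect q x)
    ((q + 1) / 2 * (y `^ q - x `^ q + q * y `^ (q - 1) * (x - y))).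
Proof.
move=> y0; rewrite /trapezoid_defect.
have h1 := is_derive1_powR (q + 1) y0.
have h2 := is_derive1_powR q y0.
apply: is_derive_eq; rewrite /GRing.scale /=.
by rewrite addrK; field.
Qed.

(** The derivative of the error with respect to the right endpoint compares x^p
    with the tangent at that endpoint. *)
Lemma trapezoid_le_concave p x y : 0 < x -> x <= y -> 0 <= p <= 1 ->
  (p + 1) / 2 * (y - x) * (y `^ p + x `^ p) <= y `^ (p + 1) - x `^ (p + 1).
Proof.
move=> x0 xy p01; have /andP[p0 p1] := p01.
suff : trapezoid_defect p x x <= trapezoid_defect p x y.
  by rewrite /trapezoid_defect subrr mulr0 mul0r subr0; lra.
apply: (le_of_derive_ge0 xy) => z /andP[xz zy].
  by apply: trapezoid_defect_derive; lra.
apply: mulr_ge0; first by lra.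
have z0 : 0 < z by lra.
by have := powR_le_tangent z0 x0 p01; lra.
Qed.

Lemma trapezoid_ge_convex q x y : 0 < x -> x <= y -> -1 <= q <= 0 ->
  y `^ (q + 1) - x `^ (q + 1) <= (q + 1) / 2 * (y - x) * (y `^ q + x `^ q).
Proof.
move=> x0 xy q01; have /andP[q0 q1] := q01.
suff : - trapezoid_defect q x x <= - trapezoid_defect q x y.
  by rewrite /trapezoid_defect subrr mulr0 mul0r subr0; lra.
apply: (@le_of_derive_ge0 _ (fun y => - trapezoid_defect q x y)
  (fun y => - ((q + 1) / 2 * (y `^ q - x `^ q + q * y `^ (q - 1) * (x - y))))
  x y xy) => z /andP[xz zy].
  by apply: is_deriveN; apply: trapezoid_defect_derive; lra.
rewrite -mulrN; apply: mulr_ge0; first by lra.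
have z0 : 0 < z by lra.
by have := powR_ge_tangent_neg z0 x0 q01; lra.
Qed.

Let is_derive_powR_shift q x : 0 < x ->
  is_derive x 1 (fun y => (y + 1) `^ q) (q * (x + 1) `^ (q - 1)).
Proof.
move=> x0; have x10 : 0 < x + 1 by lra.
have h1 := is_derive1_powR q x10.
have h2 : is_derive x 1 (fun y : R => y + 1) 1.
  by apply: is_derive_eq; rewrite addr0.
have := @is_derive1_comp _ (fun y => y `^ q) (fun y : R => y + 1) x _ _ h1 h2.
by rewrite mulr1.
Qed.

Lemma power_incr_le p x : 0 < x -> 0 <= p <= 1 ->
  power_incr p x <= p * x `^ (p - 1).
Proof.
move=> x0 p01; have x10 : 0 < x + 1 by lra.
by have := powR_le_tangent x0 x10 p01; rewrite /power_incr; lra.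
Qed.

Lemma power_incr_ge p x : 0 < x -> 0 <= p <= 1 ->
  p * (x + 1) `^ (p - 1) <= power_incr p x.
Proof.
move=> x0 p01; have x10 : 0 < x + 1 by lra.
by have := powR_le_tangent x10 x0 p01; rewrite /power_incr; lra.
Qed.

Lemma trapezoid_gap_ge0 p x : 0 < x -> 0 <= p <= 1 -> 0 <= trapezoid_gap p x.
Proof.
move=> x0 p01; have /andP[p0 p1] := p01.
have xx1 : x <= x + 1 by lra.
have := trapezoid_le_concave x0 xx1 p01.
have -> : x + 1 - x = 1 by ring.
rewrite mulr1 /trapezoid_gap subr_ge0 => h.
have p10 : 0 < p + 1 by lra.
rewrite [leRHS]mulrC ler_pdivlMr//; lra.
Qed.

(** The derivative of the trapezoidal error for x^p is the trapezoidal error for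
    p x^(p-1), which is convex. *)
Lemma trapezoid_gap_nonincreasing p x y : 0 < x -> x <= y -> 0 <= p <= 1 ->
  trapezoid_gap p y <= trapezoid_gap p x.
Proof.
move=> x0 xy p01; have /andP[p0 p1] := p01.
rewrite -lerN2.
apply: (@le_of_derive_ge0 _ (fun y => - trapezoid_gap p y)
  (fun z => - ((z + 1) `^ p - z `^ p
                - 2^-1 * (p * (z + 1) `^ (p - 1) + p * z `^ (p - 1)))) x y xy)
  => z /andP[xz zy].
  have z0 : 0 < z by lra.
  apply: is_deriveN; rewrite /trapezoid_gap.
  have h1 := is_derive1_powR (p + 1) z0.
  have h2 := is_derive1_powR p z0.
  have h3 := is_derive_powR_shift (p + 1) z0.
  have h4 := is_derive_powR_shift p z0.
  apply: is_derive_eq; rewrite /GRing.scale /= addrK; field; lra.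
rewrite oppr_ge0 subr_le0.
have z0 : 0 < z by lra.
have zz1 : z <= z + 1 by lra.
have q01 : -1 <= p - 1 <= 0 by lra.
have := trapezoid_ge_convex z0 zz1 q01.
have -> : z + 1 - z = 1 by ring.
by rewrite mulr1 subrK; lra.
Qed.

Lemma power_incr_gap_nonincreasing p x y : 0 < x -> x <= y -> 0 <= p <= 1 ->
  power_incr p y - trapezoid_gap p y <= power_incr p x - trapezoid_gap p x.
Proof.
move=> x0 xy p01; have /andP[p0 p1] := p01.
rewrite -lerN2.
apply: (@le_of_derive_ge0 _ (fun y => - (power_incr p y - trapezoid_gap p y))
  (fun z => - (p * (z + 1) `^ (p - 1) - p * z `^ (p - 1)
     - ((z + 1) `^ p - z `^ p
                - 2^-1 * (p * (z + 1) `^ (p - 1) + p * z `^ (p - 1))))) x y xy)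
  => z /andP[xz zy].
  have z0 : 0 < z by lra.
  apply: is_deriveN; rewrite /trapezoid_gap /power_incr.
  have h1 := is_derive1_powR (p + 1) z0.
  have h2 := is_derive1_powR p z0.
  have h3 := is_derive_powR_shift (p + 1) z0.
  have h4 := is_derive_powR_shift p z0.
  apply: is_derive_eq; rewrite /GRing.scale /= addrK; field; lra.
rewrite oppr_ge0 subr_le0.
have z0 : 0 < z by lra.
have zz1 : z <= z + 1 by lra.
have q01 : p - 1 <= 0 by lra.
have := power_incr_ge z0 p01; rewrite /power_incr.
have := ler_wpM2l p0 (ler_powR_npos z0 zz1 q01).
lra.
Qed.

(** The integral of t^p over the cell is at most the value at the right end, so
    the difference is at least half the increment of x^p. *)
Lemma power_incr_gap_ge p x : 0 < x -> 0 <= p <= 1 ->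
  p / 2 * (x + 1) `^ (p - 1) <= power_incr p x - trapezoid_gap p x.
Proof.
move=> x0 p01; have /andP[p0 p1] := p01.
have p10 : 0 < p + 1 by lra.
have x10 : 0 < x + 1 by lra.
have h : (p + 1)^-1 * ((x + 1) `^ (p + 1) - x `^ (p + 1)) <= (x + 1) `^ p.
  rewrite mulrC ler_pdivrMr//.
  by have := powR_ge_tangent_succ x10 x0 p01; lra.
have := power_incr_ge x0 p01; rewrite /power_incr /trapezoid_gap; lra.
Qed.

End power_cells.

(** * Euler's integral and the functional equation of Gamma *)

Section improper.
Variable R : realType.
Implicit Types (f F : R -> R) (a b t z : R).
Local Notation mu := lebesgue_measure.

Lemma derivable_continuous_at f t : derivable f t 1 -> {for t, continuous f}.
Proof. by move=> df; apply: differentiable_continuous; exact/derivable1_diffP. Qed.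

Lemma integral_derive_pos f F a b : 0 < a -> a < b ->
  (forall t, 0 < t -> is_derive t 1 F (f t)) ->
  (forall t, 0 < t -> derivable f t 1) ->
  (\int[mu]_(t in `[a, b]) (f t)%:E = (F b - F a)%:E)%E.
Proof.
move=> a0 ab dF df.
have cF t : 0 < t -> {for t, continuous F}.
  by move=> /dF[dFt _]; exact: derivable_continuous_at.
rewrite EFinB; apply: continuous_FTC2 => //.
- apply: derivable_within_continuous => t /[!in_itv]/= /andP[at_ _].
  by apply: df; lra.
- split.
  + by move=> t /[!in_itv]/= /andP[at_ _]; have [] := dF t (lt_trans a0 at_).
  + exact/cvg_at_right_filter/cF.
  + exact/cvg_at_left_filter/cF/(lt_trans a0).
- move=> t /[!in_itv]/= /andP[at_ _]; rewrite derive1E.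
  by have [_ ->] := dF t (lt_trans a0 at_).
Qed.

(** Compact intervals increasing to ]0, +oo[, on which the kernel of Euler's
    integral is smooth; the shift by 2 makes every one of them nondegenerate. *)
Definition exhaust n : set R := `[n.+2%:R^-1, n.+2%:R].

Lemma exhaust_nondecreasing : nondecreasing_seq exhaust.
Proof.
move=> m n mn; apply/subsetPset => t; rewrite /exhaust /= !in_itv /=.
move=> /andP[h1 h2]; apply/andP; split.
  by apply: le_trans h1; rewrite lef_pV2 ?posrE ?ltr0n// ler_nat !ltnS.
by apply: le_trans h2 _; rewrite ler_nat !ltnS.
Qed.

Lemma bigcup_exhaust : \bigcup_n exhaust n = `]0%R, +oo[%classic.
Proof.
apply/seteqP; split => t.
  move=> [n _]; rewrite /exhaust /= !in_itv /= => /andP[h1 _].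
  by rewrite andbT; apply: lt_le_trans h1; rewrite invr_gt0 ltr0n.
rewrite /= in_itv /= andbT => t0.
exists (Num.truncn t + Num.truncn t^-1)%N => //.
rewrite /exhaust /= in_itv /=.
have t'0 : 0 < t^-1 by rewrite invr_gt0.
have h1 := truncnS_gt t; have h2 := truncnS_gt t^-1.
set m := Num.truncn t in h1 *; set k := Num.truncn t^-1 in h2 *.
have hm : m.+1%:R <= (m + k).+2%:R :> R by rewrite ler_nat; lia.
have hk : k.+1%:R <= (m + k).+2%:R :> R by rewrite ler_nat; lia.
apply/andP; split; last by lra.
rewrite -[leRHS]invrK lef_pV2 ?posrE ?ltr0n//; lra.
Qed.

Lemma integral_exhaust_cvg f :
  (forall t, 0 < t -> 0 <= f t) -> (forall t, 0 < t -> derivable f t 1) ->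
  (\int[mu]_(t in exhaust n) (f t)%:E @[n --> \oo] -->
   \int[mu]_(t in `]0%R, +oo[) (f t)%:E)%E.
Proof.
move=> f0 df; rewrite -bigcup_exhaust.
have ex0 n t : exhaust n t -> 0 < t.
  rewrite /exhaust /= in_itv /= => /andP[h1 _].
  by apply: lt_le_trans h1; rewrite invr_gt0 ltr0n.
apply: ge0_nondecreasing_set_cvg_integral.
- exact: exhaust_nondecreasing.
- by move=> n; exact: measurable_itv.
- move=> n; apply/measurable_EFinP; apply: subspace_continuous_measurable_fun.
    exact: measurable_itv.
  apply: derivable_within_continuous => t /[!in_itv]/= /andP[h1 _].
  by apply: df; apply: lt_le_trans h1; rewrite invr_gt0 ltr0n.
- by move=> n t /ex0 /f0; rewrite lee_fin.
Qed.

End improper.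

Section gamma.
Variable R : realType.
Implicit Types (a b t z q : R).
Local Notation mu := lebesgue_measure.

Definition gamma_kernel z t : R := t `^ (z - 1) * expR (- t).

Let kernel_derive z t : 0 < t ->
  is_derive t 1 (fun t => t `^ z * expR (- t))
    (z * gamma_kernel z t - gamma_kernel (z + 1) t).
Proof.
move=> t0.
have h1 := is_derive1_powR z t0.
have h2 : is_derive t 1 (fun t => expR (- t)) (- expR (- t)).
  have h3 : is_derive t 1 (fun t : R => - t) (- 1) by apply: is_derive_eq.
  have := @is_derive1_comp _ expR (fun t : R => - t) t _ _ (is_derive_expR _) h3.
  by rewrite mulrN1.
apply: is_derive_eq; rewrite /GRing.scale /= /gamma_kernel addrK; ring.
Qed.

Let kernel_derivable z t : 0 < t -> derivable (gamma_kernel z) t 1.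
Proof. by move=> t0; have [] := kernel_derive (z - 1) t0. Qed.

Lemma gamma_kernel_ge0 z t : 0 <= gamma_kernel z t.
Proof. by rewrite mulr_ge0 ?powR_ge0 ?expR_ge0. Qed.

(** This is t / q <= exp (t / q) raised to the power q. *)
Lemma powR_le_expR q t : 0 < q -> 0 < t -> t `^ q <= q `^ q * expR t.
Proof.
move=> q0 t0; have tq0 : 0 < t / q by rewrite divr_gt0.
have h : t <= q * expR (t / q).
  by rewrite mulrC -ler_pdivrMr//; have := expR_ge1Dx (t / q); lra.
have : t `^ q <= (q * expR (t / q)) `^ q.
  by rewrite ge0_ler_powR ?nnegrE ?mulr_ge0 ?expR_ge0 ?(ltW q0) ?(ltW t0).
rewrite powRM ?expR_ge0 ?(ltW q0)// => /le_trans; apply.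
rewrite {2}/powR gt_eqF ?expR_gt0// expRK mulrC mulrCA.
by rewrite divff ?mulr1 ?gt_eqF// mulrC.
Qed.

(** A bound for the kernel, up to a constant, on all of ]0, +oo[ at once: it is
    the derivative of the bounded function - 1 / (1 + t^z). *)
Let majorant z t : R := z * t `^ (z - 1) / (1 + t `^ z) ^+ 2.

Let majorant_derive z t : 0 < t ->
  is_derive t 1 (fun t => - (1 + t `^ z)^-1) (majorant z t).
Proof.
move=> t0; have h1 := is_derive1_powR z t0.
have p0 : 1 + t `^ z != 0 by rewrite gt_eqF// ltr_wpDr// powR_ge0.
have h2 : is_derive t 1 (fun t => 1 + t `^ z) (z * t `^ (z - 1)).
  by apply: is_derive_eq; rewrite add0r mul1r.
have h3 := @is_deriveV _ (fun t => 1 + t `^ z) t _ 1 p0 h2.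
by rewrite /majorant; apply: is_derive_eq; rewrite /GRing.scale /=; field.
Qed.

Let majorant_derivable z t : 0 < t -> derivable (majorant z) t 1.
Proof.
move=> t0; have h1 := is_derive1_powR z t0.
have h2 := is_derive1_powR (z - 1) t0.
have p0 : (1 + t `^ z) ^+ 2 != 0.
  by rewrite sqrf_eq0 gt_eqF// ltr_wpDr// powR_ge0.
have h3 : is_derive t 1 (fun t => (1 + t `^ z) ^+ 2)
   ((1 + t `^ z) * (z * t `^ (z - 1)) *+ 2).
  by apply: is_derive_eq; rewrite /GRing.scale /= add0r; ring.
have h4 := @is_deriveV _ (fun t => (1 + t `^ z) ^+ 2) t _ 1 p0 h3.
by rewrite /majorant; apply: derivableM; [apply: derivableM|].
Qed.

Let kernel_le_majorant z t : 0 < z -> 0 < t ->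
  gamma_kernel z t <= 2 * (1 + (2 * z) `^ (2 * z)) / z * majorant z t.
Proof.
move=> z0 t0; set K := (2 * z) `^ (2 * z).
have K0 : 0 <= K by apply: powR_ge0.
have h : t `^ (z * 2) <= K * expR t.
  by rewrite mulrC powR_le_expR// mulr_gt0.
have e1 : 1 <= expR t by rewrite -expR0 ler_expR ltW.
have sq : t `^ (z * 2) = (t `^ z) ^+ 2 by rewrite powRrM powR_mulrn ?powR_ge0.
rewrite sq in h.
have P0 := powR_ge0 t z.
have main : (1 + t `^ z) ^+ 2 <= 2 * (1 + K) * expR t.
  by have := sqr_ge0 (1 - t `^ z); nra.
have q0 : 0 < (1 + t `^ z) ^+ 2 by rewrite exprn_gt0// ltr_wpDr.
rewrite /majorant /gamma_kernel.
have -> : 2 * (1 + K) / z * (z * t `^ (z - 1) / (1 + t `^ z) ^+ 2) =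
  t `^ (z - 1) * (2 * (1 + K) / (1 + t `^ z) ^+ 2).
  have n1 : 1 + t `^ z != 0 by rewrite gt_eqF// ltr_wpDr.
  have n2 : z != 0 by rewrite gt_eqF.
  by field; rewrite n1 n2.
rewrite ler_wpM2l ?powR_ge0// ler_pdivlMr// expRN.
by rewrite mulrC ler_pdivrMr ?expR_gt0.
Qed.

Let kernel_measurable z a b : 0 < a ->
  measurable_fun `[a, b] (EFin \o gamma_kernel z).
Proof.
move=> a0; apply/measurable_EFinP; apply: subspace_continuous_measurable_fun.
  exact: measurable_itv.
apply: derivable_within_continuous => t /[!in_itv]/= /andP[h1 _].
by apply: kernel_derivable; exact: lt_le_trans h1.
Qed.

Let exhaust_bounds n : 0 < n.+2%:R^-1 :> R /\ n.+2%:R^-1 < n.+2%:R :> R.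
Proof.
split; first by rewrite invr_gt0 ltr0n.
apply: (@lt_trans _ _ 1); last by rewrite ltr1n.
by rewrite invf_lt1 ?ltr0n// ltr1n.
Qed.

Let kernel_integral_bounded z n : 0 < z ->
  (\int[mu]_(t in @exhaust R n) (gamma_kernel z t)%:E <=
   (2 * (1 + (2 * z) `^ (2 * z)) / z)%:E)%E.
Proof.
move=> z0; set C := 2 * _ / z.
have C0 : 0 <= C.
  by rewrite divr_ge0 ?mulr_ge0 ?addr_ge0 ?powR_ge0 ?ltW.
have [a0 ab] := exhaust_bounds n.
have mE : measurable (@exhaust R n) by exact: measurable_itv.
apply: (@le_trans _ _ (\int[mu]_(t in @exhaust R n) (C * majorant z t)%:E)%E).
  apply: ge0_le_integral => //.
  - by move=> t _; rewrite lee_fin gamma_kernel_ge0.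
  - exact: kernel_measurable.
  - apply/measurable_EFinP; apply: subspace_continuous_measurable_fun => //.
    apply: derivable_within_continuous => t /[!in_itv]/= /andP[h1 _].
    by apply: derivableM => //; apply: majorant_derivable; exact: lt_le_trans h1.
  - move=> t; rewrite /exhaust /= in_itv /= => /andP[h1 _].
    by rewrite lee_fin kernel_le_majorant//; exact: lt_le_trans h1.
have dM t : 0 < t ->
    is_derive t 1 (fun t => C * - (1 + t `^ z)^-1) (C * majorant z t).
  move=> t0; have h := majorant_derive z t0.
  by apply: is_derive_eq; rewrite /GRing.scale /=; ring.
have dm t : 0 < t -> derivable (fun t => C * majorant z t) t 1.
  by move=> t0; apply: derivableM => //; apply: majorant_derivable.
rewrite /exhaust (integral_derive_pos a0 ab dM dm).
rewrite lee_fin -mulrBr -[leRHS]mulr1 ler_wpM2l// opprK addrC.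
set x := n.+2%:R; have P0 := powR_ge0 x z; have Q0 := powR_ge0 x^-1 z.
have h1 : (1 + x^-1 `^ z)^-1 <= 1 by rewrite invf_le1; lra.
have h2 : 0 <= (1 + x `^ z)^-1 by rewrite invr_ge0; lra.
lra.
Qed.

Let kernel_cvg z : (\int[mu]_(t in @exhaust R n) (gamma_kernel z t)%:E @[n --> \oo]
  --> \int[mu]_(t in `]0%R, +oo[) (gamma_kernel z t)%:E)%E.
Proof.
apply: integral_exhaust_cvg => t t0; first exact: gamma_kernel_ge0.
exact: kernel_derivable.
Qed.

Lemma gamma_integral_fin_num z : 0 < z ->
  (\int[mu]_(t in `]0%R, +oo[) (gamma_kernel z t)%:E)%E \is a fin_num.
Proof.
move=> z0; rewrite ge0_fin_numE; last first.
  by apply: integral_ge0 => t _; rewrite lee_fin gamma_kernel_ge0.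
apply: (@le_lt_trans _ _ (2 * (1 + (2 * z) `^ (2 * z)) / z)%:E); last first.
  exact: ltry.
rewrite -(cvg_lim _ (@kernel_cvg z))//; apply: lime_le.
  by apply/cvg_ex; eexists; exact: kernel_cvg.
by near=> n; exact: kernel_integral_bounded.
Unshelve. all: by end_near. Qed.

Let kernel_Rcvg z : 0 < z ->
  \int[mu]_(t in @exhaust R n) gamma_kernel z t @[n --> \oo] --> euler_integral z.
Proof.
move=> z0; apply: fine_cvg; rewrite /euler_integral /Rintegral fineK.
  exact: kernel_cvg.
exact: gamma_integral_fin_num.
Qed.

Let kernel_integrable z n :
  mu.-integrable (@exhaust R n) (EFin \o gamma_kernel z).
Proof.
have [a0 ab] := exhaust_bounds n.
apply: continuous_compact_integrable; first exact: segment_compact.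
apply: derivable_within_continuous => t /[!in_itv]/= /andP[h1 _].
by apply: kernel_derivable; exact: lt_le_trans h1.
Qed.

(** Integration by parts on a compact interval, obtained by integrating the
    derivative of t^z exp (- t). *)
Let kernel_by_parts z n :
  z * \int[mu]_(t in @exhaust R n) gamma_kernel z t
  - \int[mu]_(t in @exhaust R n) gamma_kernel (z + 1) t =
  n.+2%:R `^ z * expR (- n.+2%:R) - n.+2%:R^-1 `^ z * expR (- n.+2%:R^-1).
Proof.
have [a0 ab] := exhaust_bounds n.
have mE : measurable (exhaust n : set (measurableTypeR R)).
  exact: measurable_itv.
rewrite -RintegralZl// -RintegralB//; last first.
  by have := integrableZl mE z (kernel_integrable z n).
have dm t : 0 < t ->
    derivable (fun t => z * gamma_kernel z t - gamma_kernel (z + 1) t) t 1.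
  move=> t0; apply: derivableB; last exact: kernel_derivable.
  by apply: derivableM => //; exact: kernel_derivable.
by rewrite /Rintegral (integral_derive_pos a0 ab (kernel_derive z) dm).
Qed.

Let invn_cvg0 : n.+2%:R^-1 @[n --> \oo] --> (0 : R).
Proof.
have := @cvg_harmonic R; rewrite -(cvg_shiftS (@harmonic R)) /harmonic.
exact.
Qed.

Let boundary_cvg z : 0 < z ->
  n.+2%:R `^ z * expR (- n.+2%:R) - n.+2%:R^-1 `^ z * expR (- n.+2%:R^-1)
    @[n --> \oo] --> (0 : R).
Proof.
move=> z0; rewrite -[X in _ --> X](subrr 0); apply: cvgB.
  set K := (z + 1) `^ (z + 1).
  apply: (@squeeze_cvgr _ _ _ _ (fun=> 0) (fun n => K * n.+2%:R^-1)).
  (* t^(z+1) <= K exp t, that is t^z exp (- t) <= K / t, controls the upper end. *)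
  - near=> n; set t : R := n.+2%:R; have t0 : 0 < t by rewrite ltr0n.
    rewrite mulr_ge0 ?powR_ge0 ?expR_ge0//= expRN.
    have := @powR_le_expR (z + 1) t; rewrite powRS// -/K => h.
    rewrite ler_pdivrMr ?expR_gt0// mulrAC ler_pdivlMr// mulrC.
    by apply: h => //; lra.
  - exact: cvg_cst.
  - by rewrite -[X in _ --> X](mulr0 K); apply: cvgMr; exact: invn_cvg0.
apply: (@squeeze_cvgr _ _ _ _ (fun=> 0) (fun n => n.+2%:R^-1 `^ z)).
- near=> n; set t : R := n.+2%:R^-1.
  rewrite mulr_ge0 ?powR_ge0 ?expR_ge0//= ler_piMr ?powR_ge0//.
  by rewrite -expR0 ler_expR oppr_le0 invr_ge0.
- exact: cvg_cst.
- have /cvg_at_rightP h := @powR_cvg0 R z z0.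
  apply: (h (fun n => n.+2%:R^-1)); split; last exact: invn_cvg0.
  by move=> n; rewrite invr_gt0 ltr0n.
Unshelve. all: by end_near. Qed.

Lemma euler_integral_rec z : 0 < z -> euler_integral (z + 1) = z * euler_integral z.
Proof.
move=> z0; apply/esym/eqP; rewrite -subr_eq0; apply/eqP.
have z10 : 0 < z + 1 by lra.
have h1 : z * \int[mu]_(t in @exhaust R n) gamma_kernel z t
  - \int[mu]_(t in @exhaust R n) gamma_kernel (z + 1) t @[n --> \oo] -->
  z * euler_integral z - euler_integral (z + 1).
  by apply: cvgB; [apply: cvgMr|]; exact: kernel_Rcvg.
have <- := cvg_lim (@Rhausdorff R) h1.
under eq_fun do rewrite kernel_by_parts.
exact: cvg_lim (boundary_cvg z0).
Qed.

(** The kernel is at least exp (- 2) / 2 on [1, 2], since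
    t^(z-1) = t^z / t >= 1 / 2 there. *)
Lemma euler_integral_gt0 z : 0 < z -> 0 < euler_integral z.
Proof.
move=> z0; have c0 : 0 < expR (- 2) / 2 :> R by rewrite divr_gt0 ?expR_gt0.
suff : ((expR (- 2) / 2)%:E <=
   \int[mu]_(t in `]0%R, +oo[) (gamma_kernel z t)%:E)%E.
  rewrite -[X in (_ <= X)%E]fineK ?gamma_integral_fin_num// lee_fin.
  exact: lt_le_trans.
apply: (@le_trans _ _ (\int[mu]_(t in @exhaust R 0) (gamma_kernel z t)%:E)%E).
  have mE : measurable (@exhaust R 0) by exact: measurable_itv.
  pose c : R := expR (- 2) / 2.
  have -> : (expR (- 2) / 2)%:E = (\int[mu]_(t in `[1%R, 2%R]) ((fun=> c) t)%:E)%E.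
    (* The constant is integrated as the derivative of c t. *)
    have dF (t : R) : 0 < t -> is_derive t 1 (fun t => c * t) c.
      by move=> _; apply: is_derive_eq; rewrite /GRing.scale /= mulr1.
    have df (t : R) : 0 < t -> derivable (fun=> c) t 1 by [].
    rewrite (integral_derive_pos _ _ dF df)//; last by rewrite ltr1n.
    by congr EFin; rewrite /c; ring.
  apply: (@le_trans _ _ (\int[mu]_(t in `[1%R, 2%R]) (gamma_kernel z t)%:E)%E).
    apply: ge0_le_integral => //.
    - by move=> t _; rewrite lee_fin ltW.
    - exact: kernel_measurable.
    - move=> t; rewrite /= in_itv /= => /andP[t1 t2]; rewrite lee_fin.
      rewrite /c /gamma_kernel mulrC; apply: ler_pM; rewrite ?expR_ge0 ?invr_ge0//; last first.
        by rewrite ler_expR lerN2.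
      have t0 : 0 < t by lra.
      have e := powRB1 z t0; have h : 1 <= t `^ z.
        by rewrite -(powRr0 t) ler_powR// ltW.
      rewrite -(ler_pM2l t0) -e; lra.
  apply: ge0_subset_integral => //.
  - by apply: kernel_measurable; rewrite invr_gt0.
  - by move=> t _; rewrite lee_fin gamma_kernel_ge0.
  - move=> t; rewrite /exhaust /= !in_itv /= => /andP[t1 t2]; apply/andP; split => //.
    by apply: le_trans t1; rewrite invf_le1// ler1n.
have mE : measurable (@exhaust R 0) by exact: measurable_itv.
apply: ge0_subset_integral => //.
- apply/measurable_EFinP; apply: open_continuous_measurable_fun.
    exact: interval_open.
  move=> t; rewrite inE /= in_itv /= andbT => t0.
  exact/derivable_continuous_at/kernel_derivable.
- by move=> t _; rewrite lee_fin gamma_kernel_ge0.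
- rewrite -bigcup_exhaust; exact: bigcup_sup.
Qed.

Lemma Gamma_gt0 z : 0 < z -> 0 < Gamma z.
Proof. by move=> z0; rewrite /Gamma z0 euler_integral_gt0. Qed.

(** At a negative integer both sides vanish by the convention on poles, so that
    only z = 0 is excluded. *)
Lemma Gamma_rec z : z != 0 -> Gamma (z + 1) = z * Gamma z.
Proof.
move=> zn0; rewrite /Gamma; case: (ltP 0 z) => [z0|z0].
  by rewrite (lt_trans z0) ?ltrDl// euler_integral_rec.
case: ltP => [z1|z1].
  have -> : Num.truncn (- z) = 0%N by apply/eqP; rewrite truncn_eq; lra.
  by rewrite big_ord_recl big_ord0 /= addr0 mulr1 mulrC divfK.
set n := Num.truncn (- (z + 1)).
have -> : Num.truncn (- z) = n.+1.
  have w0 : 0 <= - (z + 1) by lra.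
  apply/eqP; rewrite truncn_eq; last by lra.
  have /andP[h1 h2] := truncn_itv w0; rewrite -/n -natr1 in h1 h2.
  by rewrite -!natr1; apply/andP; split; lra.
rewrite [in RHS]big_ord_recl /= addr0.
have -> : z + 1 + n.+1%:R = z + n.+2%:R by rewrite -[in RHS]natr1; ring.
have -> : \prod_(i < n.+1) (z + 1 + i%:R) = \prod_(i < n.+1) (z + (bump 0 i)%:R).
  by apply: eq_bigr => i _; rewrite /bump /= add1n -natr1; ring.
by rewrite mulrA invfM mulrACA divff// mul1r.
Qed.

End gamma.

(** * Coefficients of the time discretization for one order *)

Section time_coefficients.
Variables (R : realType) (sigma al : R).
Hypotheses (sigma_bounds : 2^-1 <= sigma <= 1) (al_bounds : 0 <= al <= 1).

Let p01 : 0 <= 1 - al <= 1. Proof. by move: al_bounds; lra. Qed.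
Let sigma0 : 0 < sigma. Proof. by move: sigma_bounds; lra. Qed.

Let node (l : nat) : R := l%:R - 1 + sigma.

Let node_gt0 l : (1 <= l)%N -> 0 < node l.
Proof.
rewrite /node -(ler_nat R) => l1; move: sigma_bounds; lra.
Qed.

Let node_le l : node l <= node l.+1.
Proof. by rewrite /node -natr1; lra. Qed.

Let nodeD1 l : l%:R + sigma = node l + 1. Proof. by rewrite /node; ring. Qed.

Let coef_aE l : (1 <= l)%N -> coef_a sigma al l = power_incr (1 - al) (node l).
Proof. by case: l => // l _; rewrite /coef_a /= nodeD1. Qed.

Let coef_bE l : coef_b sigma al l = trapezoid_gap (1 - al) (node l).
Proof.
rewrite /coef_b nodeD1 /trapezoid_gap -/(node l).
by have -> : 1 - al + 1 = 2 - al by ring.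
Qed.

Let coef_b_ge0 l : (1 <= l)%N -> 0 <= coef_b sigma al l.
Proof. by move=> l1; rewrite coef_bE trapezoid_gap_ge0 ?node_gt0. Qed.

Let coef_b_nonincreasing l : (1 <= l)%N ->
  coef_b sigma al l.+1 <= coef_b sigma al l.
Proof.
by move=> l1; rewrite !coef_bE trapezoid_gap_nonincreasing ?node_gt0 ?node_le.
Qed.

Let coef_a_gap_nonincreasing l : (1 <= l)%N ->
  coef_a sigma al l.+1 - coef_b sigma al l.+1 <=
  coef_a sigma al l - coef_b sigma al l.
Proof.
move=> l1; rewrite !coef_bE !coef_aE//.
by rewrite power_incr_gap_nonincreasing ?node_gt0 ?node_le.
Qed.

Lemma coef_c_nonincreasing n k : (1 <= k)%N -> (k.+1 < n)%N ->
  coef_c sigma al n k.+1 <= coef_c sigma al n k.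
Proof.
move=> k1 kn; rewrite /coef_c.
rewrite (_ : (n == 1)%N = false) /=; last by lia.
rewrite (_ : (k == 0)%N = false) /=; last by lia.
rewrite (_ : (k <= n - 2)%N = true) /=; last by lia.
have := coef_a_gap_nonincreasing k1.
have := coef_b_nonincreasing (ltn0Sn k : (1 <= k.+1)%N).
have := coef_b_ge0 (ltn0Sn k : (1 <= k.+1)%N).
by case: ifP => _; lra.
Qed.

(** For n >= 2 this is the bound on a - b over the cell ending at n - 1 + sigma;
    for n = 1 the coefficient is sigma^(1-al), which is at least sigma >= 1/2. *)
Lemma coef_c_last_ge n : (1 <= n)%N ->
  (1 - al) / 2 * n%:R `^ (- al) <= coef_c sigma al n n.-1.
Proof.
move=> n1; have [->|n_neq1] := eqVneq n 1%N.
  rewrite powR1 mulr1 /coef_c /= /coef_a /=.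
  have sle : sigma <= sigma `^ (1 - al).
    apply: ger1_powR; move: sigma_bounds al_bounds; lra.
  by move: sigma_bounds al_bounds; lra.
have n2 : (1 < n)%N by lia.
rewrite /coef_c (negbTE n_neq1).
rewrite (_ : (n.-1 == 0)%N = false) /=; last by lia.
rewrite (_ : (n.-1 <= n - 2)%N = false) /=; last by lia.
have n1' : (1 <= n.-1)%N by lia.
rewrite coef_aE// coef_bE.
apply: le_trans (power_incr_gap_ge (node_gt0 n1') p01).
rewrite ler_wpM2l//; first by move: al_bounds; lra.
have -> : 1 - al - 1 = - al by ring.
apply: ler_powR_npos; first by have := node_gt0 n1'; lra.
  rewrite /node -subn1 natrB//; move: sigma_bounds; lra.
by move: al_bounds; lra.
Qed.

Lemma coef_c_first_gt0 n : 0 < coef_c sigma al n 0.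
Proof.
rewrite /coef_c /=; have h : 0 < coef_a sigma al 0 by rewrite /coef_a powR_gt0.
by case: ifP => // _; rewrite ltr_wpDr// coef_b_ge0.
Qed.

(** The difference between the two sides is a nonnegative combination of b_1,
    b_1 - b_2 and b_2, plus the slack in
    sigma^2 a_1 <= (1 - al) sigma^(2-al) and in 1 <= 2 / (2 - al).  The constant
    2 is the only possible one: the case al = 0 requires at least 2 and the case
    al = 1 at most 2. *)
Lemma coef_c_first_ge n : (2 <= n)%N ->
  2 * (sigma `^ (1 - al) * (sigma - (1 - al / 2)) / (2 - al)) <=
  (2 * sigma - 1) * coef_c sigma al n 0 - sigma ^+ 2 * coef_c sigma al n 1.
Proof.
move=> n2; rewrite /coef_c /=.
rewrite (_ : (n == 1)%N = false) /=; last by lia.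
have b2 := coef_b_ge0 (isT : (1 <= 2)%N).
have b1 := coef_b_ge0 (isT : (1 <= 1)%N).
have b12 := coef_b_nonincreasing (isT : (1 <= 1)%N).
have a1 : sigma ^+ 2 * coef_a sigma al 1 <= (1 - al) * (sigma * sigma `^ (1 - al)).
  have := power_incr_le (node_gt0 (isT : (1 <= 1)%N)) p01.
  rewrite -coef_aE// {1}/node subrr add0r => h.
  have -> : sigma * sigma `^ (1 - al) = sigma ^+ 2 * sigma `^ (1 - al - 1).
    by rewrite (powRB1 (1 - al))// mulrA.
  by have := ler_wpM2l (sqr_ge0 sigma) h; lra.
have a0 : coef_a sigma al 0 = sigma `^ (1 - al) by [].
have P0 : 0 < sigma `^ (1 - al) by apply: powR_gt0.
have e : 2 * (sigma `^ (1 - al) * (sigma - (1 - al / 2)) / (2 - al)) =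
  (2 * sigma - 1) * sigma `^ (1 - al)
  - 2 * (1 - al) / (2 - al) * (sigma * sigma `^ (1 - al)).
  by field; move: al_bounds; lra.
have c : (1 - al) * (sigma * sigma `^ (1 - al)) <=
   2 * (1 - al) / (2 - al) * (sigma * sigma `^ (1 - al)).
  apply: ler_wpM2r; first by rewrite mulr_ge0 ?ltW.
  rewrite ler_pdivlMr; last by move: al_bounds; lra.
  by move: al_bounds => /andP[? ?]; nra.
have s1 : 0 <= 2 * sigma - 1 by move: sigma_bounds; lra.
have d1 := mulr_ge0 s1 b1.
have d2 : 0 <= sigma ^+ 2 * (coef_b sigma al 1 - coef_b sigma al 2).
  by rewrite mulr_ge0 ?sqr_ge0// subr_ge0.
have d3 : 0 <= sigma ^+ 2 * coef_b sigma al 2 by rewrite mulr_ge0 ?sqr_ge0.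
rewrite e a0; case: ifP => _; lra.
Qed.

End time_coefficients.

(** * The discrete Riesz derivative *)

Section riesz.
Variables (R : realType) (s : R).
Hypothesis s_bounds : 1 < s < 2.

Local Notation g := (coef_g s).

(** No argument of Gamma met below is a pole, as s / 2 lies strictly between 1/2
    and 1. *)
Let half_not_int (k : int) : s / 2 - k%:~R != 0.
Proof.
rewrite subr_eq0; apply/eqP => e.
have h0 : (0 : int)%:~R < k%:~R :> R by rewrite -e; move: s_bounds; lra.
have h1 : k%:~R < (1 : int)%:~R :> R by rewrite -e; move: s_bounds; lra.
by move: h0 h1; rewrite !ltr_int; lia.
Qed.

Lemma coef_g_rec (k : int) :
  g (k + 1) * (s / 2 + k%:~R + 1) = g k * (k%:~R - s / 2).
Proof.
rewrite /coef_g.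
have n1 := half_not_int k; have n2 := half_not_int (- k - 1).
have e2 : s / 2 - (- k - 1)%:~R = s / 2 + k%:~R + 1.
  by rewrite rmorphB rmorphN /=; ring.
rewrite e2 in n2.
have -> : s / 2 - (k + 1)%:~R + 1 = s / 2 - k%:~R by rewrite rmorphD /=; ring.
have -> : s / 2 + (k + 1)%:~R + 1 = s / 2 + k%:~R + 1 + 1.
  by rewrite rmorphD /=; ring.
rewrite (Gamma_rec n1) (Gamma_rec n2) expfzDr ?oppr_eq0 ?oner_eq0// expr1z.
rewrite !invfM.
set A := (Gamma (s / 2 - k%:~R))^-1; set B := (Gamma (s / 2 + k%:~R + 1))^-1.
rewrite -[k%:~R - _]opprB.
set x := s / 2 - k%:~R in n1 *; set y := s / 2 + k%:~R + 1 in n2 *.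
by field; rewrite n1 n2.
Qed.

Lemma coef_gN (k : int) : g (- k) = g k.
Proof.
rewrite /coef_g -exprz_inv invrN1 rmorphN /= opprK.
by rewrite [Gamma (s / 2 + k%:~R + 1) * _]mulrC.
Qed.

Lemma coef_g0_gt0 : 0 < g 0.
Proof.
have h1 : 0 < Gamma (s + 1) by apply: Gamma_gt0; move: s_bounds; lra.
have h2 : 0 < Gamma (s / 2 + 1) by apply: Gamma_gt0; move: s_bounds; lra.
by rewrite /coef_g expr0z mul1r subr0 addr0 divr_gt0// mulr_gt0.
Qed.

Lemma coef_g_lt0 (k : nat) : (1 <= k)%N -> g k%:Z < 0.
Proof.
case: k => // k _; elim: k => [|k IH].
  have := coef_g_rec 0; rewrite add0r sub0r addr0 => e.
  have : g 1 * (s / 2 + 1) < 0.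
    by rewrite e mulrN oppr_lt0 mulr_gt0 ?coef_g0_gt0//; move: s_bounds; lra.
  by rewrite pmulr_llt0//; move: s_bounds; lra.
have := coef_g_rec k.+1%:Z; rewrite -PoszD addn1 pmulrn => e.
have k1 : 1 <= k.+1%:R :> R by rewrite ler1n.
have : g k.+2%:Z * (s / 2 + k.+1%:R + 1) < 0.
  by rewrite e pmulr_llt0//; move: s_bounds; lra.
by rewrite pmulr_llt0//; move: s_bounds; lra.
Qed.

Lemma coef_g_le0 (k : int) : k != 0 -> g k <= 0.
Proof.
case: k => [[|k]|k] // _; apply: ltW; first exact: coef_g_lt0.
by rewrite NegzE coef_gN coef_g_lt0.
Qed.

(** For k >= 1 this is the sum of |g_j| over j >= k, in closed form. *)
Definition riesz_tail (k : int) : R := - (s / 2 + k%:~R) * g k / s.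

Lemma riesz_tail_succ (k : int) : riesz_tail (k + 1) = riesz_tail k + g k.
Proof.
rewrite /riesz_tail rmorphD /= addrA mulNr [_ * g (k + 1)]mulrC coef_g_rec.
by field; move: s_bounds; lra.
Qed.

Lemma riesz_tail_reflect (k : int) : - riesz_tail (1 - k) = riesz_tail k.
Proof.
have := riesz_tail_succ (- k); rewrite addrC => ->.
rewrite coef_gN /riesz_tail coef_gN rmorphN /=.
by field; move: s_bounds; lra.
Qed.

(** The entries telescope along the row, and the reflection formula turns the
    lower end of the telescope into a tail. *)
Lemma riesz_row_sum (M i : nat) :
  (1 <= M)%N ->
  \sum_(1 <= p < M) g (i%:Z - p%:Z) = riesz_tail i%:Z + riesz_tail (M%:Z - i%:Z).
Proof.
move=> M1.
rewrite (eq_bigr (fun p : nat => - riesz_tail (i%:Z - p.+1%:Z + 1)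
    - - riesz_tail (i%:Z - p%:Z + 1))); last first.
  move=> p _; rewrite (_ : i%:Z - p.+1%:Z + 1 = i%:Z - p%:Z); last by lia.
  by rewrite riesz_tail_succ; ring.
rewrite (telescope_sumr (fun p : nat => - riesz_tail (i%:Z - p%:Z + 1)))//.
rewrite opprK addrC subrK; congr (_ + _).
by rewrite -[in RHS]riesz_tail_reflect; congr (- riesz_tail _); lia.
Qed.

Lemma riesz_tail_nonincreasing (j k : nat) : (1 <= j)%N -> (j <= k)%N ->
  riesz_tail k%:Z <= riesz_tail j%:Z.
Proof.
move=> j1 jk; rewrite -(subnKC jk); elim: (k - j)%N => [|d IH].
  by rewrite addn0.
apply: le_trans IH; rewrite addnS -addn1 PoszD riesz_tail_succ gerDl.
by rewrite ltW// coef_g_lt0; lia.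
Qed.

Lemma riesz_tail_ratio (k : nat) :
  riesz_tail k.+1%:Z * (k%:R + s / 2) = riesz_tail k%:Z * (k%:R - s / 2).
Proof.
rewrite -addn1 PoszD riesz_tail_succ /riesz_tail pmulrn.
by field; move: s_bounds; lra.
Qed.

Lemma riesz_tail_gt0 (k : nat) : (1 <= k)%N -> 0 < riesz_tail k%:Z.
Proof.
move=> k1; rewrite /riesz_tail divr_gt0//; last by move: s_bounds; lra.
rewrite mulNr oppr_gt0 pmulr_rlt0 ?coef_g_lt0//.
by have := ler0n R k; rewrite -pmulrn; move: s_bounds; lra.
Qed.

(** Write z^s = z * z^(s-1) with z = (k - 1) / k and bound the second factor by
    Bernoulli's inequality; what remains is a polynomial inequality. *)
Lemma ratio_ge_powR (k : nat) : (2 <= k)%N ->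
  ((k%:R - 1) / k%:R) `^ s <= (k%:R - s / 2) / (k%:R + s / 2).
Proof.
move=> k2; set x : R := k%:R.
have x2 : 2 <= x by rewrite (ler_nat R 2).
have z0 : 0 < (x - 1) / x by rewrite divr_gt0; lra.
have -> : s = (s - 1) + 1 by ring.
rewrite powRS// subrK.
have q01 : 0 <= s - 1 <= 1 by move: s_bounds; lra.
have h := powR_le_tangent1 z0 q01.
apply: le_trans (ler_wpM2l (ltW z0) h) _.
have -> : (x - 1) / x * (1 + (s - 1) * ((x - 1) / x - 1)) =
  (x - 1) * (x - s + 1) / x ^+ 2 by field; lra.
rewrite ler_pdivlMr; last by move: s_bounds; lra.
rewrite mulrAC ler_pdivrMr ?exprn_gt0//; last lra.
rewrite -subr_ge0.
have -> : (x - s / 2) * x ^+ 2 - (x - 1) * (x - s + 1) * (x + s / 2) =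
  (s ^+ 2 / 2 - s + 1) * x - (s - 1) * (s / 2) by field.
have sq : 0 <= s ^+ 2 / 2 - s + 1 by have := sqr_ge0 (s - 1); lra.
have := ler_wpM2l sq x2; have := sqr_ge0 (s - 3 / 2); lra.
Qed.

Lemma riesz_tail_ge_powR (k : nat) : (3 <= k)%N ->
  riesz_tail 3%:Z * (2 / (k%:R - 1)) `^ s <= riesz_tail k%:Z.
Proof.
move=> k3; rewrite -(subnKC k3); elim: (k - 3)%N => [|d IH].
  by rewrite addn0 (_ : 3%:R - 1 = 2) ?divff ?powR1 ?mulr1//; ring.
rewrite addnS; set j := (3 + d)%N in IH *.
have j3 : (3 <= j)%N by rewrite /j; lia.
have x3 : 3 <= j%:R :> R by rewrite ler_nat.
set x : R := j%:R in IH x3 *.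
have -> : riesz_tail j.+1%:Z = riesz_tail j%:Z * ((x - s / 2) / (x + s / 2)).
  rewrite mulrA -riesz_tail_ratio mulfK// gt_eqF//; move: s_bounds; lra.
have r := @ratio_ge_powR j (ltnW j3); rewrite -/x in r.
have r0 : 0 <= ((x - 1) / x) `^ s by exact: powR_ge0.
have IH0 : 0 <= riesz_tail 3%:Z * (2 / (x - 1)) `^ s.
  by rewrite mulr_ge0 ?powR_ge0// ltW// riesz_tail_gt0.
have := ler_pM IH0 r0 IH r; apply: le_trans.
rewrite -[leRHS]mulrA -powRM; [|by rewrite divr_ge0; lra..].
have -> : j.+1%:R - 1 = x by rewrite -natr1 addrK.
suff -> : 2 / (x - 1) * ((x - 1) / x) = 2 / x by [].
by field; lra.
Qed.

(** The rational factor of r_s times g_0 is |g_3|: the constant is calibrated on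
    the tail of index 3. *)
Lemma coef_r_eq : coef_r s = expR (- 2) * (s * riesz_tail 3%:Z) * (3 + s / 2) `^ s.
Proof.
have sb := s_bounds.
rewrite /coef_r powRS; last by lra.
have g0E : Gamma (s + 1) / Gamma (s / 2 + 1) ^+ 2 = g 0.
  by rewrite /coef_g expr0z mul1r subr0 addr0 expr2.
rewrite g0E.
have e0 : g 1 = - g 0 * s / (2 + s).
  have := coef_g_rec 0; rewrite add0r sub0r addr0 => e.
  by apply: (@mulIf _ (s / 2 + 1)); [lra|rewrite e; field; lra].
have e1 : g 2%:Z = g 1 * (2 - s) / (4 + s).
  have := coef_g_rec 1 => e.
  by apply: (@mulIf _ (s / 2 + 1 + 1)); [lra|rewrite e; field; lra].
have e2 : g 3%:Z = g 2%:Z * (4 - s) / (6 + s).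
  have := coef_g_rec 2 => e.
  by apply: (@mulIf _ (s / 2 + 2 + 1)); [lra|rewrite e; field; lra].
rewrite /riesz_tail e2 e1 e0 -pmulrn.
by field; lra.
Qed.

(** The product of the ratio bounds telescopes to (2 / (M - 1))^s, which exceeds
    ((3 + s/2) / (2 M))^s; the factor exp (- 2) <= 1 is dropped. *)
Lemma riesz_tail_ge_coef_r (M : nat) : (2 <= M)%N ->
  coef_r s / s * (2 * M%:R) `^ (- s) <= riesz_tail M%:Z.
Proof.
move=> M2; have sb := s_bounds; rewrite coef_r_eq.
have t3 := @riesz_tail_gt0 3 isT.
have x2 : 2 <= M%:R :> R by rewrite ler_nat.
set x : R := M%:R in x2 *.
have e1 : expR (- 2) <= 1 :> R by rewrite -expR0 ler_expR.
have -> : expR (- 2) * (s * riesz_tail 3%:Z) * (3 + s / 2) `^ s / s *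
   (2 * x) `^ (- s) = expR (- 2) * (riesz_tail 3%:Z * ((3 + s / 2) / (2 * x)) `^ s).
  have i0 : 0 <= (2 * x)^-1 by rewrite invr_ge0; lra.
  rewrite [((3 + s / 2) / (2 * x)) `^ s]powRM//; last by lra.
  have -> : (2 * x)^-1 `^ s = (2 * x) `^ (- s).
    by rewrite -powR_inv1 -?powRrM ?mulN1r//; lra.
  by field; lra.
set y := (3 + s / 2) / (2 * x).
have y0 : 0 <= y by rewrite divr_ge0; lra.
apply: (@le_trans _ _ (riesz_tail 3%:Z * y `^ s)).
  by rewrite ler_piMl// mulr_ge0 ?powR_ge0// ltW.
have [M3|M3] := leqP 3 M.
  apply: le_trans (riesz_tail_ge_powR M3); rewrite -/x.
  have x3 : 3 <= x by rewrite (ler_nat R 3).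
  have z0 : 0 <= 2 / (x - 1) by rewrite divr_ge0; lra.
  rewrite ler_wpM2l ?(ltW t3)// ge0_ler_powR ?nnegrE//; try lra.
  rewrite ler_pdivrMr; last lra.
  rewrite mulrAC ler_pdivlMr; last lra.
  have : 0 <= (2 - s) * (x - 1) by apply: mulr_ge0; lra.
  lra.
have -> : M = 2%N by lia.
apply: (@le_trans _ _ (riesz_tail 3%:Z)); last exact: riesz_tail_nonincreasing.
rewrite ler_piMr ?(ltW t3)//.
apply: (@le_trans _ _ (1 `^ s)); last by rewrite powR1.
rewrite ge0_ler_powR ?nnegrE//; first lra.
by rewrite ler_pdivrMr; lra.
Qed.

(** Diagonal dominance: v_i v_p <= (v_i^2 + v_p^2) / 2 is used with the
    nonpositive off-diagonal entries, and symmetry collects the row sums. *)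
Lemma riesz_form_ge (M : nat) (v : nat -> R) : (2 <= M)%N ->
  v 0%N = 0 -> v M = 0 ->
  cstar s * (2 * M%:R) `^ (- s) * \sum_(1 <= i < M) v i ^+ 2 <=
  \sum_(1 <= i < M) riesz_sum s M v i * v i.
Proof.
move=> M2 v0 vM.
pose q i p := g (i%:Z - p%:Z).
have rE i : riesz_sum s M v i = \sum_(1 <= p < M) q i p * v p.
  rewrite /riesz_sum big_nat_recr//= vM mulr0 addr0.
  by rewrite big_ltn ?v0 ?mulr0 ?add0r//; lia.
apply: (@le_trans _ _
    (\sum_(1 <= i < M) \sum_(1 <= p < M) q i p * (v i ^+ 2 + v p ^+ 2) / 2)).
  have -> : \sum_(1 <= i < M) \sum_(1 <= p < M) q i p * (v i ^+ 2 + v p ^+ 2) / 2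
      = \sum_(1 <= i < M) v i ^+ 2 * \sum_(1 <= p < M) q i p.
    have h : \sum_(1 <= i < M) \sum_(1 <= p < M) q i p * v p ^+ 2 =
             \sum_(1 <= i < M) \sum_(1 <= p < M) q i p * v i ^+ 2.
      rewrite exchange_big /=; apply: eq_bigr => i _; apply: eq_bigr => p _.
      by rewrite /q -coef_gN opprB.
    have -> : \sum_(1 <= i < M) \sum_(1 <= p < M) q i p * (v i ^+ 2 + v p ^+ 2) / 2
      = 2^-1 * (\sum_(1 <= i < M) \sum_(1 <= p < M) q i p * v i ^+ 2 +
                \sum_(1 <= i < M) \sum_(1 <= p < M) q i p * v p ^+ 2).
      rewrite -big_split mulr_sumr; apply: eq_bigr => i _ /=.
      rewrite -big_split mulr_sumr; apply: eq_bigr => p _ /=; ring.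
    have half2 (x : R) : 2^-1 * (x + x) = x by field.
    rewrite h half2.
    by apply: eq_bigr => i _; rewrite mulr_sumr; apply: eq_bigr => p _; rewrite mulrC.
  rewrite mulr_sumr; apply: ler_sum_nat => i /andP[i1 iM].
  rewrite [leRHS]mulrC; apply: ler_wpM2r; first exact: sqr_ge0.
  rewrite /q riesz_row_sum; last by lia.
  have h := riesz_tail_ge_coef_r M2.
  have h1 := riesz_tail_nonincreasing i1 (ltnW iM).
  have h2 := @riesz_tail_nonincreasing (M - i) M.
  rewrite -subzn ?(ltnW iM)// in h2.
  have {}h2 := h2 _ (leq_subr _ _).
  have : riesz_tail M%:Z <= riesz_tail (M%:Z - i%:Z) by apply: h2; lia.
  rewrite /cstar; lra.
apply: ler_sum_nat => i /andP[i1 iM]; rewrite rE mulr_suml.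
apply: ler_sum_nat => p /andP[p1 pM].
have [->|ip] := eqVneq i p; first by rewrite le_eqVlt; apply/orP; left; apply/eqP; field.
have q0 : q i p <= 0 by apply: coef_g_le0; rewrite subr_eq0; apply: contra ip => /eqP[->].
rewrite -!(mulrA (q i p)); apply: ler_wnM2l => //.
by have := sqr_ge0 (v i - v p); lra.
Qed.

End riesz.

(** * Summation by parts and the energy inequality *)

Section abel.
Variable R : realType.
Implicit Types (c E u : nat -> R) (sigma : R).

(** Summation by parts for a nonincreasing c: the discarded terms are
    (c_(k-1) - c_k) E_k with a < k < n, so the sign of E is needed at interior
    indices only. *)
Lemma abel_sum_ge c E a n : (a < n)%N ->
  (forall k, (a <= k)%N -> (k.+1 < n)%N -> c k.+1 <= c k) ->
  (forall k, (a < k < n)%N -> 0 <= E k) ->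
  c n.-1 * E n - c a * E a <= \sum_(a <= k < n) c k * (E k.+1 - E k).
Proof.
elim: n => // n IH; rewrite ltnS leq_eqVlt => /predU1P[<- _ _|an cc E0].
  by rewrite big_nat1 mulrBr.
rewrite big_nat_recr /=; last exact: ltnW.
have {}IH : c n.-1 * E n - c a * E a <= \sum_(a <= k < n) c k * (E k.+1 - E k).
  apply: IH => // k; first by move=> ak kn; apply: cc => //; lia.
  by move=> kn; apply: E0; lia.
have En : 0 <= E n by apply: E0; lia.
have cn : c n <= c n.-1.
  by have := cc n.-1; rewrite prednK; [apply; lia | lia].
by have := ler_wpM2r En cn; lra.
Qed.

(** With E_k = (w - u^(n-k))^2, where w is the first factor on the right, the
    difference of the two sides is half the sum of the c_k (E_(k+1) - E_k).  The
    weight 2 sigma - 1 of c_0 is the difference of the coefficients sigma^2 and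
    (1 - sigma)^2 of (u^n - u^(n-1))^2 in E_1 and E_0. *)
Lemma discrete_energy_ge c u sigma n : (1 <= n)%N ->
  (forall k, (1 <= k)%N -> (k.+1 < n)%N -> c k.+1 <= c k) ->
  0 <= c n.-1 -> 0 <= (2 * sigma - 1) * c 0%N ->
  ((2 <= n)%N -> sigma ^+ 2 * c 1%N <= (2 * sigma - 1) * c 0%N) ->
  2^-1 * \sum_(0 <= k < n) c k * (u (n - k)%N ^+ 2 - u (n - k - 1)%N ^+ 2) <=
  (sigma * u n + (1 - sigma) * u (n - 1)%N) *
    \sum_(0 <= k < n) c k * (u (n - k)%N - u (n - k - 1)%N).
Proof.
move=> n1 cc cn c0 c1.
set w := sigma * u n + (1 - sigma) * u (n - 1)%N.
pose E k := (w - u (n - k)%N) ^+ 2.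
have E0 k : 0 <= E k by exact: sqr_ge0.
rewrite -subr_ge0 !mulr_sumr -sumrB.
rewrite (eq_bigr (fun k => 2^-1 * (c k * (E k.+1 - E k)))); last first.
  by move=> k _; rewrite /E (_ : n - k.+1 = n - k - 1)%N; [field|lia].
rewrite -mulr_sumr mulr_ge0// big_ltn//.
set d := u n - u (n - 1)%N.
have e0 : E 0%N = (1 - sigma) ^+ 2 * d ^+ 2 by rewrite /E subn0 /w /d; ring.
have e1 : E 1%N = sigma ^+ 2 * d ^+ 2 by rewrite /E /w /d; ring.
have d0 : 0 <= d ^+ 2 by exact: sqr_ge0.
have [n2|n2] := leqP 2 n; last first.
  have -> : n = 1%N by lia.
  rewrite big_geq// e0 e1; have := mulr_ge0 c0 d0; lra.
have := @abel_sum_ge c E 1 n n2 cc (fun k _ => E0 k).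
have := mulr_ge0 cn (E0 n).
have := ler_wpM2r d0 (c1 n2).
rewrite e0 e1; lra.
Qed.

(** Summation by parts applied to B - e_(n-k), which is nonnegative for
    0 < k < n: all terms other than those of e_n and e_0 have a good sign. *)
Lemma discrete_comparison c e n B G : (1 <= n)%N ->
  (forall k, (k.+1 < n)%N -> c k.+1 <= c k) -> 0 < c 0%N ->
  (forall j, (j < n)%N -> e j <= B) ->
  \sum_(0 <= k < n) c k * (e (n - k)%N - e (n - k - 1)%N) <= G ->
  G <= c n.-1 * (B - e 0%N) -> e n <= B.
Proof.
move=> n1 cc c0 eB sG GB; pose X k : R := B - e (n - k)%N.
have X0 k : (0 < k < n)%N -> 0 <= X k.
  by move=> kn; rewrite subr_ge0 eB//; lia.
have := @abel_sum_ge c X 0 n n1 (fun k _ => cc k) X0.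
rewrite (eq_bigr (fun k => c k * (e (n - k)%N - e (n - k - 1)%N))); last first.
  by move=> k _; rewrite /X (_ : n - k.+1 = n - k - 1)%N; [ring|lia].
rewrite {1 2}/X subnn subn0 => h.
have : 0 <= c 0%N * (B - e n) by lra.
by rewrite pmulr_rge0// subr_ge0.
Qed.

End abel.

(** * Coefficients of the distributed-order time discretization *)

Section chat.
Variables (R : realType) (omega : R -> R) (J : nat) (tau sigma : R).
Hypotheses (J_gt0 : (1 <= J)%N) (tau_gt0 : 0 < tau).
Hypothesis omega_pos : forall a : R, 0 <= a <= 1 -> 0 <= omega a /\ omega a <> 0.

Local Notation m := (2 * J)%N.
Local Notation al := (alpha R J).
Local Notation lam := (lambda omega J).

Lemma alpha_bounds r : (r <= m)%N -> 0 <= al r <= 1.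
Proof.
move=> rm; rewrite /alpha divr_ge0//= ler_pdivrMr ?mul1r ?ler_nat//.
by rewrite ltr0n; lia.
Qed.

Lemma lambda_gt0 r : (r <= m)%N -> 0 < lam r.
Proof.
move=> rm; have [w0 w1] := omega_pos (alpha_bounds rm).
rewrite /lambda !mulr_gt0//; first by case: ifP.
  by rewrite lt_neqAle w0 andbT eq_sym; apply/eqP.
by rewrite invr_gt0 ltr0n; lia.
Qed.

Let sum_gt0 (f : nat -> R) : 0 < f 0%N ->
  (forall r, (r <= m)%N -> 0 <= f r) -> 0 < \sum_(0 <= r < m.+1) f r.
Proof.
move=> f0 fr; rewrite big_ltn// ltr_wpDr// big_nat_cond sumr_ge0// => r.
by rewrite andbT => /andP[_ rm]; apply: fr.
Qed.

Lemma sigmaF_neg s : 0 < s -> s < 2^-1 -> sigmaF omega J tau s < 0.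
Proof.
move=> s0 s2; rewrite -oppr_gt0 /sigmaF -sumrN.
have t r : (r <= m)%N -> 0 < - (lam r / Gamma (3 - al r) * s `^ (1 - al r) *
    (s - (1 - al r / 2)) * tau `^ (2 - al r)).
  move=> rm; have ab := alpha_bounds rm.
  rewrite -mulNr -mulrN; apply: mulr_gt0; last exact: powR_gt0.
  apply: mulr_gt0; last lra.
  apply: mulr_gt0; last exact: powR_gt0.
  by apply: divr_gt0; [exact: lambda_gt0|apply: Gamma_gt0; lra].
by apply: sum_gt0 => [|r rm]; [exact: t|exact/ltW/t].
Qed.

Lemma sigmaF_pos s : 1 < s -> 0 < sigmaF omega J tau s.
Proof.
move=> s1; rewrite /sigmaF.
have t r : (r <= m)%N -> 0 < lam r / Gamma (3 - al r) * s `^ (1 - al r) *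
    (s - (1 - al r / 2)) * tau `^ (2 - al r).
  move=> rm; have ab := alpha_bounds rm.
  apply: mulr_gt0; last exact: powR_gt0.
  apply: mulr_gt0; last lra.
  apply: mulr_gt0; last by apply: powR_gt0; lra.
  by apply: divr_gt0; [exact: lambda_gt0|apply: Gamma_gt0; lra].
by apply: sum_gt0 => [|r rm]; [exact: t|exact/ltW/t].
Qed.

(** Outside [1/2, 1] all terms of F have the same strict sign, since
    1 - alpha_r / 2 lies in that interval. *)
Lemma is_sigma_bounds : is_sigma omega J tau sigma -> 2^-1 <= sigma <= 1.
Proof.
move=> [s0 F0]; apply/andP; split; rewrite leNgt; apply/negP => h.
  by have := sigmaF_neg s0 h; rewrite F0 ltxx.
by have := sigmaF_pos h; rewrite F0 ltxx.
Qed.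

Hypothesis sigmaP : is_sigma omega J tau sigma.

Let sb : 2^-1 <= sigma <= 1. Proof. exact: is_sigma_bounds. Qed.

Let weight r : R := lam r * (tau `^ (- al r) / Gamma (2 - al r)).

Let weight_gt0 r : (r <= m)%N -> 0 < weight r.
Proof.
move=> rm; have ab := alpha_bounds rm.
apply: mulr_gt0; first exact: lambda_gt0.
by rewrite divr_gt0 ?powR_gt0 ?Gamma_gt0//; lra.
Qed.

Let ler_sum_weight (f g : nat -> R) : (forall r, (r <= m)%N -> f r <= g r) ->
  \sum_(0 <= r < m.+1) f r <= \sum_(0 <= r < m.+1) g r.
Proof. by move=> fg; apply: ler_sum_nat => r /andP[_ rm]; apply: fg. Qed.

Local Notation ch := (chat omega J tau sigma).

Lemma chat_first_gt0 n : 0 < ch n 0.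
Proof.
have t r : (r <= m)%N -> 0 < weight r * coef_c sigma (al r) n 0.
  move=> rm; apply: mulr_gt0; first exact: weight_gt0.
  by apply: coef_c_first_gt0 => //; exact: alpha_bounds.
by apply: sum_gt0 => [|r rm]; [exact: t|exact/ltW/t].
Qed.

Lemma chat_nonincreasing1 n k : (1 <= k)%N -> (k.+1 < n)%N ->
  ch n k.+1 <= ch n k.
Proof.
move=> k1 kn; apply: ler_sum_weight => r rm.
rewrite ler_wpM2l ?(ltW (weight_gt0 rm))// coef_c_nonincreasing//.
exact: alpha_bounds.
Qed.

(** Summing the bounds for the single orders gives 2 F(sigma) / tau^2 = 0. *)
Lemma chat_first_ge n : (2 <= n)%N ->
  sigma ^+ 2 * ch n 1 <= (2 * sigma - 1) * ch n 0.
Proof.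
move=> n2; rewrite -subr_ge0 /chat !mulr_sumr -sumrB.
have [_ F0] := sigmaP.
apply: (@le_trans _ _ (2 * tau `^ (-2) * sigmaF omega J tau sigma)).
  by rewrite F0 mulr0.
rewrite /sigmaF mulr_sumr; apply: ler_sum_weight => r rm.
have ab := alpha_bounds rm.
have := ler_wpM2l (ltW (weight_gt0 rm)) (coef_c_first_ge sb ab n2).
rewrite -/(weight r) => h.
have -> : 2 * tau `^ (-2) * (lam r / Gamma (3 - al r) * sigma `^ (1 - al r) *
   (sigma - (1 - al r / 2)) * tau `^ (2 - al r)) = weight r *
      (2 * (sigma `^ (1 - al r) * (sigma - (1 - al r / 2)) / (2 - al r))).
  have a2 : 2 - al r != 0 by rewrite gt_eqF//; lra.
  have G2 : Gamma (2 - al r) != 0 by rewrite gt_eqF// Gamma_gt0//; lra.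
  have -> : 3 - al r = 2 - al r + 1 by ring.
  have t2 : tau `^ (- al r) = tau `^ (-2) * tau `^ (2 - al r).
    rewrite -powRD; last by apply/implyP => _; rewrite gt_eqF.
    by congr (_ `^ _); ring.
  by rewrite /weight t2 Gamma_rec//; field; rewrite a2 G2.
by apply: le_trans h _; lra.
Qed.

(** At z = 0 both sides vanish, by the convention 1 / Gamma 0 = 0. *)
Lemma inv_Gamma_rec (z : R) : 0 <= z -> z / Gamma (z + 1) = (Gamma z)^-1.
Proof.
rewrite le_eqVlt => /predU1P[<-|z0].
  by rewrite mul0r /Gamma ltxx big_ord_recl addr0 mul0r invr0 mulr0 invr0.
rewrite Gamma_rec ?gt_eqF//; have G0 : Gamma z != 0 by rewrite gt_eqF// Gamma_gt0.
by field; rewrite G0 gt_eqF.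
Qed.

Definition stab_weight (T : R) : R :=
  \sum_(0 <= r < m.+1) lam r / (T `^ al r * Gamma (1 - al r)).

Lemma stab_weight_gt0 T : 0 < T -> 0 < stab_weight T.
Proof.
move=> T0; apply: sum_gt0 => [|r rm].
  rewrite /alpha mul0r powRr0 subr0 mul1r.
  by rewrite divr_gt0 ?lambda_gt0 ?Gamma_gt0.
have ab := alpha_bounds rm.
rewrite divr_ge0 ?(ltW (lambda_gt0 rm))// mulr_ge0 ?powR_ge0//.
rewrite -invr_ge0 -inv_Gamma_rec; last by lra.
by apply: divr_ge0; [lra|apply/ltW/Gamma_gt0; lra].
Qed.

(** Here n tau <= N tau = T, and (1 - alpha) / Gamma (2 - alpha) is
    1 / Gamma (1 - alpha), also at alpha = 1. *)
Lemma chat_last_ge n N : (1 <= n <= N)%N ->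
  stab_weight (N%:R * tau) / 2 <= ch n n.-1.
Proof.
move=> /andP[n1 nN]; rewrite /stab_weight mulr_suml; apply: ler_sum_weight => r rm.
have ab := alpha_bounds rm.
have h := ler_wpM2l (ltW (weight_gt0 rm)) (coef_c_last_ge sb ab n1).
apply: le_trans h; rewrite invfM -powRN -inv_Gamma_rec; last by lra.
have -> : 1 - al r + 1 = 2 - al r by ring.
have G2 : 0 < Gamma (2 - al r) by rewrite Gamma_gt0//; lra.
have -> : weight r * ((1 - al r) / 2 * n%:R `^ (- al r)) =
  lam r * ((tau `^ (- al r) * n%:R `^ (- al r)) * ((1 - al r) / Gamma (2 - al r))) / 2.
  by rewrite /weight; field; rewrite gt_eqF.
rewrite ler_wpM2r// ler_wpM2l ?(ltW (lambda_gt0 rm))// ler_wpM2r//.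
  by rewrite divr_ge0 ?(ltW G2)//; lra.
rewrite mulrC -powRM ?(ltW tau_gt0)//; apply: ler_powR_npos; last lra.
  by rewrite mulr_gt0// ltr0n.
have nN' : n%:R <= N%:R :> R by rewrite ler_nat.
by have := ler_wpM2r (ltW tau_gt0) nN'; lra.
Qed.

Lemma chat_ge_last n k : (1 <= k < n)%N -> ch n n.-1 <= ch n k.
Proof.
move=> /andP[k1 kn].
suff h d : (k + d < n)%N -> ch n (k + d) <= ch n k.
  by have := h (n.-1 - k)%N; rewrite subnKC; [apply|]; lia.
elim: d => [|d IH] dn; first by rewrite addn0.
by rewrite addnS; apply: le_trans (IH _); [apply: chat_nonincreasing1|]; lia.
Qed.

Lemma chat_last_gt0 n : (1 <= n)%N -> 0 < ch n n.-1.
Proof.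
move=> n1; have nn : (1 <= n <= n)%N by rewrite n1 leqnn.
apply: lt_le_trans (chat_last_ge nn).
by rewrite divr_gt0// stab_weight_gt0// mulr_gt0// ltr0n.
Qed.

(** Only the step from 0 to 1 is not inherited from the single orders; it follows
    from (2 sigma - 1) c_1 <= sigma^2 c_1 <= (2 sigma - 1) c_0. *)
Lemma chat_nonincreasing n k : (k.+1 < n)%N -> ch n k.+1 <= ch n k.
Proof.
case: k => [n2|k kn]; last exact: chat_nonincreasing1.
have h := chat_first_ge n2; have c0 := chat_first_gt0 n.
have c1 : 0 < ch n 1.
  by apply: lt_le_trans (chat_last_gt0 (ltnW n2)) _; apply: chat_ge_last.
(* sigma = 1/2 is excluded, since it would force c_1 <= 0. *)
have s1 : 0 < 2 * sigma - 1.
  rewrite -(pmulr_lgt0 _ c0); apply: lt_le_trans h.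
  by rewrite mulr_gt0// exprn_gt0//; case: sigmaP.
rewrite -(ler_pM2l s1); apply: le_trans h.
by have := mulr_ge0 (sqr_ge0 (1 - sigma)) (ltW c1); lra.
Qed.

End chat.

(** * Energy estimate on the grid *)

Lemma cstar_gt0 (R : realType) (s : R) : 1 < s < 2 -> 0 < cstar s.
Proof.
move=> sb; apply: mulr_gt0; first by rewrite divr_gt0//; lra.
rewrite coef_r_eq//; apply: mulr_gt0; last by apply: powR_gt0; lra.
by rewrite mulr_gt0 ?expR_gt0// mulr_gt0 ?riesz_tail_gt0//; lra.
Qed.

Lemma scaled_riesz_form_ge (R : realType) (s L : R) (M : nat) (v : nat -> R) :
  1 < s < 2 -> 0 < L -> (2 <= M)%N -> v 0%N = 0 -> v M = 0 ->
  cstar s / (2 * L) `^ s * \sum_(1 <= i < M) v i ^+ 2 <=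
  (L / M%:R) `^ (- s) * \sum_(1 <= i < M) riesz_sum s M v i * v i.
Proof.
move=> sb L0 M2 v0 vM; set h := L / M%:R.
have M0 : 0 < M%:R :> R by rewrite ltr0n; lia.
have h0 : 0 < h by rewrite divr_gt0.
have e : cstar s / (2 * L) `^ s = h `^ (- s) * (cstar s * (2 * M%:R) `^ (- s)).
  have -> : 2 * L = h * (2 * M%:R) by rewrite /h; field; rewrite gt_eqF.
  rewrite -powRN powRM ?(ltW h0) ?mulr_ge0//; ring.
rewrite e -mulrA ler_wpM2l ?powR_ge0//; exact: riesz_form_ge.
Qed.

Section grid.
Variables (R : realType) (M1 M2 : nat).
Implicit Types (v w : nat -> nat -> R).

Definition grid_sum v : R := \sum_(1 <= i < M1) \sum_(1 <= j < M2) v i j.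

Lemma ler_grid_sum v w :
  (forall i j, (1 <= i <= M1 - 1)%N -> (1 <= j <= M2 - 1)%N -> v i j <= w i j) ->
  grid_sum v <= grid_sum w.
Proof.
move=> vw; apply: ler_sum_nat => i iM; apply: ler_sum_nat => j jM.
by apply: vw; lia.
Qed.

Lemma eq_grid_sum v w :
  (forall i j, (1 <= i <= M1 - 1)%N -> (1 <= j <= M2 - 1)%N -> v i j = w i j) ->
  grid_sum v = grid_sum w.
Proof.
move=> vw; apply: eq_big_nat => i iM; apply: eq_big_nat => j jM.
by apply: vw; lia.
Qed.

Lemma grid_sumD v w :
  grid_sum (fun i j => v i j + w i j) = grid_sum v + grid_sum w.
Proof.
by rewrite /grid_sum -big_split; apply: eq_bigr => i _; rewrite -big_split.
Qed.

Lemma grid_sumZ (a : R) v : grid_sum (fun i j => a * v i j) = a * grid_sum v.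
Proof.
by rewrite /grid_sum mulr_sumr; apply: eq_bigr => i _; rewrite mulr_sumr.
Qed.

Lemma grid_sumB v w :
  grid_sum (fun i j => v i j - w i j) = grid_sum v - grid_sum w.
Proof.
rewrite -mulN1r -grid_sumZ -grid_sumD; apply: eq_grid_sum => i j _ _.
by rewrite mulN1r.
Qed.

Lemma grid_sum_sum n (F : nat -> nat -> nat -> R) :
  grid_sum (fun i j => \sum_(0 <= k < n) F k i j) =
  \sum_(0 <= k < n) grid_sum (F k).
Proof.
rewrite /grid_sum [RHS]exchange_big /=; apply: eq_bigr => i _.
by rewrite exchange_big.
Qed.

Lemma grid_sum_swap v :
  grid_sum v = \sum_(1 <= j < M2) \sum_(1 <= i < M1) v i j.
Proof. by rewrite /grid_sum exchange_big. Qed.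

Definition blend (sigma : R) (u : nat -> nat -> nat -> R) (n i j : nat) : R :=
  sigma * u n i j + (1 - sigma) * u (n - 1)%N i j.

Lemma grid_energy_ge (c : nat -> R) (u : nat -> nat -> nat -> R) sigma n :
  (1 <= n)%N -> (forall k, (1 <= k)%N -> (k.+1 < n)%N -> c k.+1 <= c k) ->
  0 <= c n.-1 -> 0 <= (2 * sigma - 1) * c 0%N ->
  ((2 <= n)%N -> sigma ^+ 2 * c 1%N <= (2 * sigma - 1) * c 0%N) ->
  2^-1 * \sum_(0 <= k < n) c k * (grid_sum (fun i j => u (n - k)%N i j ^+ 2) -
                                  grid_sum (fun i j => u (n - k - 1)%N i j ^+ 2)) <=
  grid_sum (fun i j => blend sigma u n i j *
    \sum_(0 <= k < n) c k * (u (n - k)%N i j - u (n - k - 1)%N i j)).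
Proof.
move=> n1 cc cn c0 c1.
apply: (@le_trans _ _ (grid_sum (fun i j => 2^-1 *
    \sum_(0 <= k < n) c k * (u (n - k)%N i j ^+ 2 - u (n - k - 1)%N i j ^+ 2)))).
  rewrite grid_sumZ grid_sum_sum ler_wpM2l//.
  by apply: ler_sum => k _; rewrite grid_sumZ grid_sumB.
apply: ler_grid_sum => i j _ _.
exact: (@discrete_energy_ge _ c (fun k => u k i j)).
Qed.

Lemma grid_young v w B : 0 < B ->
  grid_sum (fun i j => v i j * w i j) <=
  B * grid_sum (fun i j => v i j ^+ 2) + (4 * B)^-1 * grid_sum (fun i j => w i j ^+ 2).
Proof.
move=> B0; rewrite -!grid_sumZ -grid_sumD; apply: ler_grid_sum => i j _ _.
rewrite -subr_ge0.
have -> : B * v i j ^+ 2 + (4 * B)^-1 * w i j ^+ 2 - v i j * w i j =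
  B * (v i j - w i j / (2 * B)) ^+ 2 by field; rewrite gt_eqF.
by rewrite mulr_ge0 ?sqr_ge0// ltW.
Qed.

Lemma grid_riesz1_ge (s L K : R) v :
  1 < s < 2 -> 0 < L -> 0 < K -> (2 <= M1)%N ->
  (forall j, (1 <= j <= M2 - 1)%N -> v 0%N j = 0 /\ v M1 j = 0) ->
  K * cstar s / (2 * L) `^ s * grid_sum (fun i j => v i j ^+ 2) <=
  grid_sum (fun i j => v i j * (K * (L / M1%:R) `^ (- s) *
    riesz_sum s M1 (fun p => v p j) i)).
Proof.
move=> sb L0 K0 M12 vb.
rewrite !grid_sum_swap mulr_sumr; apply: ler_sum_nat => j jM.
have [v0 vM] : v 0%N j = 0 /\ v M1 j = 0 by apply: vb; lia.
have := @scaled_riesz_form_ge R s L M1 (fun p => v p j) sb L0 M12 v0 vM.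
move=> /(ler_wpM2l (ltW K0)).
rewrite !mulrA => /le_trans; apply.
by rewrite mulr_sumr; apply: ler_sum => i _; rewrite [leRHS]mulrC mulrA.
Qed.

End grid.

Lemma grid_riesz2_ge (R : realType) (M1 M2 : nat) (s L K : R) (v : nat -> nat -> R) :
  1 < s < 2 -> 0 < L -> 0 < K -> (2 <= M2)%N ->
  (forall i, (1 <= i <= M1 - 1)%N -> v i 0%N = 0 /\ v i M2 = 0) ->
  K * cstar s / (2 * L) `^ s * grid_sum M1 M2 (fun i j => v i j ^+ 2) <=
  grid_sum M1 M2 (fun i j => v i j * (K * (L / M2%:R) `^ (- s) *
    riesz_sum s M2 (fun q => v i q) j)).
Proof.
move=> sb L0 K0 M22 vb; have := @grid_riesz1_ge R M2 M1 s L K (fun i j => v j i).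
by rewrite !(grid_sum_swap M2 M1); apply.
Qed.

Section stability.
Variables (R : realType) (L1 L2 T K1 K2 beta gamma : R) (M1 M2 N J : nat).
Variables (omega : R -> R) (sigma : R) (f : R -> R -> R -> R) (phi : R -> R -> R).
Variable u : nat -> nat -> nat -> R.
Hypotheses (L1_gt0 : 0 < L1) (L2_gt0 : 0 < L2) (T_gt0 : 0 < T).
Hypotheses (K1_gt0 : 0 < K1) (K2_gt0 : 0 < K2).
Hypotheses (beta_bounds : 1 < beta < 2) (gamma_bounds : 1 < gamma < 2).
Hypotheses (M1_ge2 : (2 <= M1)%N) (M2_ge2 : (2 <= M2)%N).
Hypotheses (N_gt0 : (1 <= N)%N) (J_gt0 : (1 <= J)%N).
Hypothesis omega_pos : forall a : R, 0 <= a <= 1 -> 0 <= omega a /\ omega a <> 0.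

Let h1 := L1 / M1%:R.
Let h2 := L2 / M2%:R.
Let tau := T / N%:R.
Let source n i j : R := f (i%:R * h1) (j%:R * h2) ((n%:R - 1 + sigma) * tau).

Hypothesis sigmaP : is_sigma omega J tau sigma.
Hypothesis scheme :
  is_scheme_solution L1 L2 T K1 K2 beta gamma M1 M2 N J omega sigma f phi u.

Let c n k := chat omega J tau sigma n k.
Let B : R := K1 * cstar beta / (2 * L1) `^ beta + K2 * cstar gamma / (2 * L2) `^ gamma.

Let N0 : 0 < N%:R :> R. Proof. by rewrite ltr0n. Qed.

Let tau_gt0 : 0 < tau. Proof. by rewrite divr_gt0. Qed.

Let B_gt0 : 0 < B.
Proof.
have L10 := L1_gt0; have L20 := L2_gt0.
apply: addr_gt0; apply: divr_gt0; try (apply: powR_gt0; lra).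
  by apply: mulr_gt0 => //; exact: cstar_gt0.
by apply: mulr_gt0 => //; exact: cstar_gt0.
Qed.

Let blend_boundary n i j : (1 <= n <= N)%N -> (i <= M1)%N -> (j <= M2)%N ->
  (i = 0 \/ i = M1 \/ j = 0 \/ j = M2)%N -> blend sigma u n i j = 0.
Proof.
move=> /andP[_ nN] iM jM ij; have [_ bnd _] := scheme.
have n1N : (n - 1 <= N)%N by apply: leq_trans (leq_subr _ _) nN.
by rewrite /blend !bnd// !mulr0 addr0.
Qed.

(** The scheme tested against w: the two Riesz terms provide - B ||w||^2, which
    absorbs the first term of Young's inequality for the source. *)
Let blend_step n : (1 <= n <= N)%N ->
  grid_sum M1 M2 (fun i j => blend sigma u n i j *
    \sum_(0 <= k < n) c n k * (u (n - k)%N i j - u (n - k - 1)%N i j)) <=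
  (4 * B)^-1 * grid_sum M1 M2 (fun i j => source n i j ^+ 2).
Proof.
move=> nN; have [eqn _ _] := scheme.
have b1 j : (1 <= j <= M2 - 1)%N ->
    blend sigma u n 0%N j = 0 /\ blend sigma u n M1 j = 0.
  move=> /andP[_ jM]; have {}jM := leq_trans jM (leq_subr _ _).
  by split; apply: blend_boundary => //; auto.
have b2 i : (1 <= i <= M1 - 1)%N ->
    blend sigma u n i 0%N = 0 /\ blend sigma u n i M2 = 0.
  move=> /andP[_ iM]; have {}iM := leq_trans iM (leq_subr _ _).
  by split; apply: blend_boundary => //; auto.
have := grid_riesz1_ge beta_bounds L1_gt0 K1_gt0 M1_ge2 b1.
have := grid_riesz2_ge gamma_bounds L2_gt0 K2_gt0 M2_ge2 b2.
have := @grid_young R M1 M2 (blend sigma u n) (source n) B B_gt0.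
rewrite -/h1 -/h2; set W := grid_sum M1 M2 (fun i j => blend sigma u n i j ^+ 2).
set Q1 := grid_sum _ _ _; set Q2 := grid_sum _ _ _; set Q3 := grid_sum _ _ _.
set Q4 := grid_sum _ _ _.
move=> young form2 form1.
suff -> : grid_sum M1 M2 (fun i j => blend sigma u n i j *
    \sum_(0 <= k < n) c n k * (u (n - k)%N i j - u (n - k - 1)%N i j)) =
    Q1 - Q3 - Q4.
  by rewrite [B * W]mulrDl in young; lra.
rewrite /Q1 /Q3 /Q4 -!grid_sumB; apply: eq_grid_sum => i j iM jM.
by rewrite eqn// /source /h1 /h2 /tau /blend; ring.
Qed.

Let nsq n : R := grid_sum M1 M2 (fun i j => u n i j ^+ 2).

Let step_energy n : (1 <= n <= N)%N ->
  \sum_(0 <= k < n) c n k * (nsq (n - k)%N - nsq (n - k - 1)%N) <=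
  (2 * B)^-1 * grid_sum M1 M2 (fun i j => source n i j ^+ 2).
Proof.
move=> nN; have /andP[n1 _] := nN.
have sb := is_sigma_bounds J_gt0 tau_gt0 omega_pos sigmaP.
have dec k : (1 <= k)%N -> (k.+1 < n)%N -> c n k.+1 <= c n k.
  by move=> _; apply: chat_nonincreasing.
have last0 : 0 <= c n n.-1 by apply/ltW/chat_last_gt0.
have first0 : 0 <= (2 * sigma - 1) * c n 0%N.
  apply: mulr_ge0; first by lra.
  exact/ltW/chat_first_gt0.
have key : (2 <= n)%N -> sigma ^+ 2 * c n 1%N <= (2 * sigma - 1) * c n 0%N.
  by move=> n2; apply: chat_first_ge.
have := grid_energy_ge M1 M2 u n1 dec last0 first0 key.
move=> /le_trans /(_ (blend_step nN)).
have -> : (4 * B)^-1 = 2^-1 * (2 * B)^-1 by field; rewrite gt_eqF.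
by rewrite -mulrA ler_pM2l.
Qed.

Let S := stab_weight omega J T.

Let S_gt0 : 0 < S. Proof. exact: stab_weight_gt0. Qed.

Lemma grid_norm_bound n F : (n <= N)%N -> 0 <= F ->
  (forall l, (1 <= l <= n)%N -> grid_sum M1 M2 (fun i j => source l i j ^+ 2) <= F) ->
  nsq n <= nsq 0%N + F / (B * S).
Proof.
move=> + F0; elim/ltn_ind: n => n IH nN sF.
have BS0 : 0 <= F / (B * S) by rewrite divr_ge0// ltW// mulr_gt0.
have [->|] := eqVneq n 0%N; first by rewrite lerDl.
rewrite -lt0n => n1.
have nN' : (1 <= n <= N)%N by rewrite n1.
have T_eq : T = N%:R * tau by rewrite /tau mulrC divfK// gt_eqF.
have last_ge : S / 2 <= c n n.-1.
  by rewrite /S T_eq; apply: chat_last_ge.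
apply: (@discrete_comparison _ (c n) nsq n _ (F / (2 * B))) => //.
- by move=> k kn; apply: chat_nonincreasing.
- exact: chat_first_gt0.
- move=> j jn; apply: IH => //; first exact: leq_trans (ltnW jn) nN.
  move=> l /andP[l1 lj]; apply: sF.
  by rewrite l1 (leq_trans lj (ltnW jn)).
- apply: le_trans (step_energy nN') _.
  rewrite mulrC ler_wpM2r//; last by apply: sF; rewrite n1 leqnn.
  by rewrite invr_ge0 mulr_ge0// ltW.
- rewrite addrAC subrr add0r.
  have -> : F / (2 * B) = S / 2 * (F / (B * S)).
    by field; rewrite !gt_eqF.
  exact: ler_wpM2r.
Qed.

End stability.

(** * The stability bound *)

Lemma cstar2 (R : realType) : cstar (2 : R) = 0.
Proof. by rewrite /cstar /coef_r subrr !(mulr0, mul0r). Qed.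

Lemma inv_add_le_mean (R : realFieldType) (x y : R) : 0 < x -> 0 < y ->
  (x + y)^-1 <= 4^-1 * (x^-1 + y^-1).
Proof.
move=> x0 y0; rewrite -subr_ge0.
have -> : 4^-1 * (x^-1 + y^-1) - (x + y)^-1 = (x - y) ^+ 2 / (4 * (x * y * (x + y))).
  by field; rewrite !gt_eqF// addr_gt0.
by rewrite divr_ge0 ?sqr_ge0// ltW// !mulr_gt0// addr_gt0.
Qed.

(* In \bar R, 0^-1 = +oo: a term with cstar = 0 is +oo. *)
Theorem theorem3p2 (R : realType) (L1 L2 T K1 K2 beta gamma : R)
    (M1 M2 N J : nat) (omega : R -> R) (sigma : R)
    (f : R -> R -> R -> R) (phi : R -> R -> R)
    (u : nat -> nat -> nat -> R) :
  0 < L1 -> 0 < L2 -> 0 < T -> 0 < K1 -> 0 < K2 ->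
  1 < beta <= 2 -> 1 < gamma <= 2 ->
  (2 <= M1)%N -> (2 <= M2)%N -> (1 <= N)%N -> (1 <= J)%N ->
  (forall a : R, 0 <= a <= 1 -> 0 <= omega a /\ omega a <> 0) ->
  (0 < \int[lebesgue_measure]_(a in `[0%R, 1%R]) (omega a)%:E < +oo)%E ->
  is_sigma omega J (T / N%:R) sigma ->
  (forall x y : R, 0 <= x <= L1 -> 0 <= y <= L2 ->
     x = 0 \/ x = L1 \/ y = 0 \/ y = L2 -> phi x y = 0) ->
  is_scheme_solution L1 L2 T K1 K2 beta gamma M1 M2 N J omega sigma f phi u ->
  let h1 := L1 / M1%:R in
  let h2 := L2 / M2%:R in
  let tau := T / N%:R in
  let fnode (l i j : nat) : R :=
    f (i%:R * h1) (j%:R * h2) ((l%:R - 1 + sigma) * tau) in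
  forall n : nat, (1 <= n <= N)%N ->
  ((normsq M1 M2 h1 h2 (u n))%:E <=
   (normsq M1 M2 h1 h2 (u 0%N))%:E +
   scale_bound
     ((4^-1)%:E *
      (((2 * L1) `^ beta)%:E / (K1 * cstar beta)%:E +
       ((2 * L2) `^ gamma)%:E / (K2 * cstar gamma)%:E) *
      ((\sum_(0 <= r < (2 * J).+1)
          lambda omega J r /
            (T `^ alpha R J r * Gamma (1 - alpha R J r)))^-1)%:E)
     (\big[Num.max/0%R]_(1 <= l < n.+1) normsq M1 M2 h1 h2 (fnode l)))%E.
Proof.
move=> L10 L20 T0 K10 K20 /andP[b1 b2] /andP[g1 g2] M12 M22 N1 J1 om _ sg _ sol.
move=> h1 h2 tau fnode n /andP[n1 nN].
set F := \big[Num.max/0%R]_(1 <= l < n.+1) _.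
rewrite -/(stab_weight omega J T).
have S0 : 0 < stab_weight omega J T by exact: stab_weight_gt0.
set S := stab_weight omega J T in S0 *.
have P10 : 0 < (2 * L1) `^ beta by apply: powR_gt0; lra.
have P20 : 0 < (2 * L2) `^ gamma by apply: powR_gt0; lra.
have Kc (K s : R) : 0 < K -> 1 < s -> s <= 2 -> s != 2 -> 0 < K * cstar s.
  move=> K0 s1 s2 sn; apply: mulr_gt0 => //; apply: cstar_gt0.
  by rewrite s1 lt_neqAle sn.
have iS0 : 0 < S^-1 by rewrite invr_gt0.
have ratio0 (p K s : R) : 0 < p -> 0 < K -> 1 < s -> s <= 2 ->
    (0 <= p%:E / (K * cstar s)%:E)%E.
  move=> p0 K0 s1 s2; rewrite inver; case: eqP => [_|/eqP n0].
    by rewrite gt0_muley ?lte_fin// leey.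
  have [e|sn] := eqVneq s 2; first by rewrite e cstar2 mulr0 eqxx in n0.
  by rewrite -EFinM lee_fin divr_ge0// ltW// Kc.
have bound_y (x : \bar R) : x = +oo%E ->
    scale_bound ((4^-1)%:E * x * (S^-1)%:E)%E F = +oo%E.
  by move=> ->; rewrite gt0_muley ?lte_fin// gt0_mulye ?lte_fin.
have ratio_nNy (p K s : R) : 0 < p -> 0 < K -> 1 < s -> s <= 2 ->
    (p%:E / (K * cstar s)%:E)%E != -oo%E.
  by move=> p0 K0 s1 s2; rewrite -ltNye; apply: lt_le_trans (ratio0 _ _ _ p0 K0 s1 s2).
have ratio_y (p K s : R) : 0 < p -> s = 2 ->
    (p%:E / (K * cstar s)%:E)%E = +oo%E.
  by move=> p0 ->; rewrite cstar2 mulr0 inver eqxx gt0_muley ?lte_fin.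
have [be|bn] := eqVneq beta 2.
  rewrite (ratio_y _ _ beta)// addye; last exact: ratio_nNy.
  by rewrite bound_y// leey.
have [ge|gn] := eqVneq gamma 2.
  rewrite (ratio_y _ _ gamma)// addey; last exact: ratio_nNy.
  by rewrite bound_y// leey.
have bb : 1 < beta < 2 by rewrite b1 lt_neqAle bn.
have gb : 1 < gamma < 2 by rewrite g1 lt_neqAle gn.
have Kc1 := Kc _ _ K10 b1 b2 bn; have Kc2 := Kc _ _ K20 g1 g2 gn.
have ratioE (p x : R) : 0 < x -> (p%:E / x%:E)%E = (p / x)%:E.
  by move=> x0; rewrite inver gt_eqF.
rewrite !ratioE// /scale_bound /= lee_fin.
have h10 : 0 < h1 by rewrite divr_gt0// ltr0n ltnW.
have h20 : 0 < h2 by rewrite divr_gt0// ltr0n ltnW.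
have hh0 : 0 < h1 * h2 by rewrite mulr_gt0.
have F0 : 0 <= F by exact: bigmax_ge_id.
have sF l : (1 <= l <= n)%N ->
    grid_sum M1 M2 (fun i j => fnode l i j ^+ 2) <= F / (h1 * h2).
  move=> ln; rewrite ler_pdivlMr// mulrC.
  apply: (@le_bigmax_seq _ _ _ _ 0 l xpredT
    (fun l => normsq M1 M2 h1 h2 (fnode l))) => //.
  by rewrite mem_index_iota ltnS.
have := grid_norm_bound L10 L20 T0 K10 K20 bb gb M12 M22 N1 J1 om sg sol nN
  (divr_ge0 F0 (ltW hh0)) sF.
move=> /(ler_wpM2l (ltW hh0)); rewrite mulrDr => /le_trans; apply.
rewrite lerD2l.
set B1 := K1 * cstar beta / _; set B2 := K2 * cstar gamma / _.
have B10 : 0 < B1 by exact: divr_gt0.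
have B20 : 0 < B2 by exact: divr_gt0.
have -> : h1 * h2 * (F / (h1 * h2) / ((B1 + B2) * stab_weight omega J T)) =
  (B1 + B2)^-1 * (F / S).
  by rewrite -/S; field; rewrite !gt_eqF// addr_gt0.
rewrite -[leRHS]mulrA [S^-1 * F]mulrC ler_wpM2r ?divr_ge0 ?(ltW S0)//.
by apply: le_trans (inv_add_le_mean B10 B20) _; rewrite !invf_div.
Qed.
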